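(* $P_2(n)\leq n^{-2+o(1)}$ as $n\to\infty$. That is, for every $\epsilon>0$ there exists $n_0$ such that $P_2(n)\le n^{-2+\epsilon}$ for all $n\ge n_0$.
   Context: $S_n$ and $A_n$ denote the symmetric and alternating groups on $n$ points. Let $P$ be the uniform probability distribution on $S_n\times S_n$. Define $$P_2(n)=P\left(\{(\pi,\sigma)\in S_n^2:\ \pi,\sigma\in H\text{ for some primitive subgroup } H\le S_n \text{ with } H\not\geq A_n\}\right),$$ where $H\not\ge A_n$ means that $H$ does not contain $A_n$, and primitive means primitive as a permutation group on the $n$ points. *)

(* Defs.v *)
From HB Require Import structures.
From mathcomp Require Import all_boot all_order all_algebra all_fingroup all_solvable.
From mathcomp Require Import reals exp.

Set Implicit Arguments.
Unset Strict Implicit.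
Unset Printing Implicit Defensive.

Import GRing.Theory Num.Theory.
Local Open Scope ring_scope.

Definition uniform_prob (R : realType) (T : finType) (E : {set T}) : R :=
  #|E|%:R / #|T|%:R.

Definition primitive_pairs (n : nat) : {set 'S_n * 'S_n} :=
  [set ps : 'S_n * 'S_n | [exists H : {group 'S_n},
     [&& ps.1 \in H, ps.2 \in H,
         [primitive H, on [set: 'I_n] | 'P] & ~~ (Alt 'I_n \subset H)]]].

Definition P2 (R : realType) (n : nat) : R := uniform_prob R (primitive_pairs n).
Arguments P2 R n : clear implicits.

(* Main.v *)
(** Let p, s be random permutations lying in a primitive group H that does not
    contain the alternating group.

    If H is not 2-transitive, it preserves an orbital E, a p-invariant relation whose
    full automorphism group is primitive and does not contain the alternating group,
    hence has index at least ceil(n/2)! by Bochert's theorem. A typical p has so few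
    orbits on pairs of points that there are at most 2^(n + n log_2(n) / 8) candidates
    for E, and a union bound over E makes this case negligible.

    If H is 2-transitive, its nontrivial elements move more than n/10 points. Let M be
    the product of the lengths of the cycles of p longer than n / polylog(n). Then p^M
    moves few points, so p^M = 1: every cycle length of p divides M, and likewise for
    s. Since M has few prime factors, most integers up to n do not divide M, and the
    event that all cycle lengths of p do has probability n^(-1+o(1)). As p and s are
    independent, this case has probability n^(-2+o(1)). *)
Require Import Defs.
From mathcomp Require Import all_boot all_order all_algebra.
From mathcomp Require Import all_fingroup all_solvable.
From mathcomp Require Import zify ring lra.
From mathcomp Require Import reals sequences exp.
From mathcomp Require boolp classical_sets topology normedtype derive realfun.

Set Implicit Arguments.
Unset Strict Implicit.
Unset Printing Implicit Defensive.

(** * Primitive permutation groups *)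

(** Write b for [trunc_log 2 n]. A typical permutation has at most 4b cycles, at most b / k of them
    longer than L = n / b^3. The cube serves both cases: since 4bL <= n / 10, the power p^M moves
    few enough points, and since 16 b^2 L <= n, the pairs with a short first coordinate need at most
    n representatives.

    The constant k is at least 8 so that Bochert's factorial wins in the first case, and large in
    terms of epsilon for the second. The proportion of permutations of u points whose cycle lengths
    have all their primes among w given ones is at most exp(S) / u, where S is the sum of 1 / l over
    such l. An Euler product bounds S; as only distinctness and parity of the primes are used, the
    bound is of order sqrt w instead of log w. With w = (b / k) b this is a small multiple of b, so
    exp(S) is a small power of n. So few long cycles can be demanded because the mean number of
    cycles longer than n / b^3 is only about 3 log b.

    All these proportions are coefficients of exp (sum_l f(l) t^l / l), estimated through their
    recursion. *)

Lemma card_bigcup_le (I T : finType) (P : pred I) (F : I -> {set T}) :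
  #|\bigcup_(i | P i) F i| <= \sum_(i | P i) #|F i|.
Proof.
apply: (big_ind2 (fun (B : {set T}) m => #|B| <= m)) => [|B m C l hB hC|//].
  by rewrite cards0.
exact: leq_trans (leq_card_setU _ _) (leq_add hB hC).
Qed.

Section Primitivity.

Local Open Scope group_scope.

(** The classes of [e] form an invariant partition. As [a] and [b] share a class there are fewer
    classes than points, so a pair outside [e] would make it an imprimitivity system. *)
Lemma primitive_rel (T : finType) (G : {group {perm T}}) (e : rel T) a b :
    [primitive G, on [set: T] | 'P] -> equivalence_rel e ->
    {in G, forall s : {perm T}, forall x y, e x y -> e (s x) (s y)} ->
  a != b -> e a b -> forall x y, e x y.
Proof.
move=> /andP[_ /existsPn noQ] eqe inve nab eab x y; apply: contraT => nexy.
have [eR eT] : reflexive e /\ (forall u v w, e u v -> e u w = e v w).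
  by split=> [u|u v w]; [case: (eqe u u u) | case: (eqe u v w)].
have eS u v : e u v -> e v u by move=> uv; rewrite -(eT u v u uv) eR.
have inve' s u v : s \in G -> e (s u) (s v) = e u v.
  move=> sG; apply/idP/idP; last exact: inve.
  by move/(inve _ (groupVr sG)); rewrite !permK.
have eqe' : {in [set: T] & &, equivalence_rel e} by move=> u v w _ _ _.
pose cl u := [set v in [set: T] | e u v].
have clP u v : (v \in cl u) = e u v by rewrite !inE.
have := noQ (equivalence_partition e setT); rewrite /imprimitivity_system.
rewrite equivalence_partitionP //=; case/nandP => [|].
  case/negP; apply/subsetP => s sG; rewrite !inE; apply/subsetP => B.
  rewrite /= inE => /imsetP[u _ ->]; apply/imsetP; exists (s u) => //.
  apply/setP=> v; apply/imsetP/idP => [[w]|]; rewrite clP.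
    by rewrite -/(cl u) clP => uw ->; rewrite inve'.
  move=> suv; exists (s^-1 v); last by rewrite /= apermE permKV.
  by rewrite -/(cl u) clP -(inve' s) // permKV.
case/negP; apply/andP; split.
  apply/card_gt1P; exists (cl x), (cl y); split; try exact: imset_f.
  apply: contra nexy => /eqP clxy; rewrite -clP clxy clP; exact: eR.
rewrite ltn_neqAle leq_imset_card andbT; apply: contra nab => /imset_injP inj.
apply/eqP/inj => //; apply/setP => v; rewrite !inE; exact: eT.
Qed.

Lemma primitiveS (T : finType) (G H : {group {perm T}}) :
    G \subset H -> [primitive G, on [set: T] | 'P] ->
  [primitive H, on [set: T] | 'P].
Proof.
move=> sGH /andP[trG /existsPn nimp]; apply/andP; split.
  case/imsetP: trG => x _ dx; apply/imsetP; exists x => //.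
  apply/eqP; rewrite eqEsubset subsetT andbT dx; exact: imsetS.
apply/existsPn => Q; apply: contra (nimp Q) => /and3P[pQ aQ cQ].
by apply/and3P; split=> //; apply: subset_trans aQ.
Qed.

End Primitivity.

(** * Three-cycles and Jordan's theorem for them *)

Section ThreeCycles.

Local Open Scope group_scope.

Variable T : finType.
Implicit Types (a b c d x y : T) (s : {perm T}) (G : {group {perm T}}).

Definition cyc3 a b c : {perm T} := tperm a b * tperm a c.

Definition has_cyc3 G a b c := uniq [:: a; b; c] && (cyc3 a b c \in G).

Lemma cyc3E a b c : uniq [:: a; b; c] ->
  [/\ cyc3 a b c a = b, cyc3 a b c b = c & cyc3 a b c c = a].
Proof.
rewrite /= !inE negb_or andbT => /andP[/andP[ab ac] bc].
rewrite /cyc3 !permM tpermL tpermR tpermL [tperm a b c]tpermD // tpermR.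
by split=> //; rewrite tpermD // eq_sym.
Qed.

Lemma cyc3D a b c x : x != a -> x != b -> x != c -> cyc3 a b c x = x.
Proof. by move=> xa xb xc; rewrite permM !tpermD // eq_sym. Qed.

Lemma cyc3_rot a b c : uniq [:: a; b; c] -> cyc3 a b c = cyc3 b c a.
Proof.
rewrite /= !inE negb_or andbT => /andP[/andP[ab ac] bc].
by rewrite /cyc3 [tperm b a]tpermC conjgCV tpermV tpermJ tpermL tpermD // eq_sym.
Qed.

Lemma cyc3V a b c : (cyc3 a b c)^-1 = cyc3 a c b.
Proof. by rewrite invMg !tpermV. Qed.

Lemma has_cyc3_rot G a b c : has_cyc3 G a b c -> has_cyc3 G b c a.
Proof.
case/andP=> u m; rewrite /has_cyc3 -cyc3_rot // m andbT.
by rewrite -(rot_uniq 2).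
Qed.

Lemma has_cyc3_flip G a b c : has_cyc3 G a b c -> has_cyc3 G a c b.
Proof.
case/andP=> u m; rewrite /has_cyc3 -cyc3V groupV m andbT.
by move: u; rewrite /= !inE !negb_or !andbT (eq_sym c b) [(a != b) && _]andbC.
Qed.

Lemma has_cyc3J G a b c s :
  s \in G -> has_cyc3 G a b c -> has_cyc3 G (s a) (s b) (s c).
Proof.
move=> sG /andP[u m]; apply/andP; split.
  by rewrite -(map_inj_uniq (@perm_inj _ s)) in u.
by have := groupJ m sG; rewrite conjMg !tpermJ.
Qed.

(** The transpositions of an even permutation are grouped in consecutive pairs. A pair with a common
    point is 1 or a 3-cycle; any other pair becomes two such pairs after inserting [tperm b c]
    twice. *)
Lemma Alt_sub_cyc3 G : (forall a b c, uniq [:: a; b; c] -> cyc3 a b c \in G) ->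
  'Alt_T \subset G.
Proof.
move=> cG; apply/subsetP=> s; rewrite Alt_even.
have [ts -> dts] := prod_tpermP s; rewrite odd_perm_prod //.
have tt a b c d : a != b -> c != d -> tperm a b * tperm c d \in G.
  have shared u v w : u != v -> u != w -> tperm u v * tperm u w \in G.
    move=> uv uw; have [<-|vw] := eqVneq v w; first by rewrite tperm2 group1.
    by apply: cG; rewrite /= !inE negb_or uv uw vw.
  move=> ab; have [<-|bc] := eqVneq b c => cd.
    by rewrite [tperm a b]tpermC; apply: shared; rewrite // eq_sym.
  have -> : tperm a b * tperm c d = tperm a b * tperm b c * (tperm b c * tperm c d).
    by rewrite -mulgA tpermKg.
  apply: groupM.
    by rewrite [tperm a b]tpermC; apply: shared; rewrite // eq_sym.
  by rewrite [tperm b c]tpermC; apply: shared; rewrite // eq_sym.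
have [n] := ubnP (size ts); elim: n ts dts => // n IH [|[a b] [|[c d] ts]] //=.
  by rewrite big_nil group1.
case/and3P=> ab cd dts; rewrite negbK !ltnS => lt odd.
by rewrite !big_cons mulgA groupM ?tt ?IH // ltnW.
Qed.

(** Jordan's theorem. Lying on a common 3-cycle of [G] is an invariant equivalence relation, so by
    primitivity any two points lie on one; conjugating these 3-cycles by one another yields all of
    them. *)
Lemma primitive_cyc3 G a b c :
    [primitive G, on [set: T] | 'P] -> has_cyc3 G a b c -> 'Alt_T \subset G.
Proof.
move=> primG abc.
pose e x y := (x == y) || [exists z, has_cyc3 G x y z].
have step x y z u v : has_cyc3 G x y u -> has_cyc3 G y z v -> x != v -> x != z ->
    has_cyc3 G x z (cyc3 y z v u).
  move=> xyu yzv xv xz; have [u2 m2] := andP yzv; have [u1 m1] := andP xyu.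
  have := has_cyc3J m2 xyu; have [-> _ _] := cyc3E u2; rewrite (cyc3D _ xz xv) //.
  by move: u1; rewrite /= inE negb_or => /andP[/andP[]].
have eS x y : e x y -> e y x.
  rewrite /e eq_sym => /predU1P[->|/existsP[z xyz]]; first by rewrite eqxx.
  apply/orP; right; apply/existsP; exists z.
  exact/has_cyc3_rot/has_cyc3_rot/has_cyc3_flip.
have eT x y z : e x y -> e y z -> e x z.
  case/predU1P => [->//|/existsP[u xyu]]; case/predU1P => [<-|/existsP[v yzv]].
    by apply/orP; right; apply/existsP; exists u.
  have [->|xz] := eqVneq x z; first by rewrite /e eqxx.
  rewrite /e (negPf xz) /=; apply/existsP.
  have [xv|xv] := eqVneq x v; last by exists (cyc3 y z v u); apply: step.
  by exists y; apply/has_cyc3_flip/has_cyc3_rot/has_cyc3_rot; rewrite xv.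
have eqe : equivalence_rel e.
  move=> x y z; split=> [|xy]; first by rewrite /e eqxx.
  by apply/idP/idP; [apply: eT (eS _ _ xy) | apply: eT xy].
have inve : {in G, forall s : {perm T}, forall x y, e x y -> e (s x) (s y)}.
  move=> s sG x y /predU1P[->|/existsP[z xyz]]; first by rewrite /e eqxx.
  by apply/orP; right; apply/existsP; exists (s z); apply: has_cyc3J.
have nab : a != b.
  by case/andP: abc; rewrite /= inE negb_or => /andP[/andP[]].
have allE x y : x != y -> exists z, has_cyc3 G x y z.
  move=> xy; apply/existsP.
  have := primitive_rel primG eqe inve nab _ x y; rewrite /e (negPf xy) /=.
  by apply; rewrite (negPf nab) /=; apply/existsP; exists c.
have {}step x y z u v : has_cyc3 G x y u -> has_cyc3 G u z v -> x != v -> y != v ->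
    x != z -> y != z -> has_cyc3 G x y z.
  move=> xyu uzv xv yv xz yz; have [u2 m2] := andP uzv; have [u1 m1] := andP xyu.
  have := has_cyc3J m2 xyu; have [-> _ _] := cyc3E u2.
  move: u1; rewrite /= !inE negb_or andbT => /andP[/andP[_ xu] yu].
  by rewrite !cyc3D.
apply: Alt_sub_cyc3 => x y z uxyz.
suff /andP[] : has_cyc3 G x y z by [].
move: uxyz; rewrite /= !inE negb_or andbT => /andP[/andP[xy xz] yz].
have [u xyu] := allE _ _ xy; have [->//|uz] := eqVneq z u.
have [v uzv] : exists v, has_cyc3 G u z v by apply: allE; rewrite eq_sym.
(* This covers v = x and v = y: conjugation by the inverse of (u z p) turns (p q u) into (z q p). *)
have key p q : has_cyc3 G p q u -> has_cyc3 G u z p -> q != z -> has_cyc3 G q p z.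
  move=> pqu uzp qz; have [u2 m2] := andP uzp.
  have [_ tz tp] := cyc3E u2; have [u1 _] := andP pqu.
  move: u1; rewrite /= !inE negb_or andbT => /andP[/andP[pq pu] qu].
  have tq : cyc3 u z p q = q by rewrite cyc3D // eq_sym.
  have := has_cyc3J (groupVr m2) pqu.
  move: (cyc3 u z p) tz tp tq => t tz tp tq.
  rewrite -[in X in has_cyc3 _ X]tz -[in X in has_cyc3 _ _ X]tq.
  by rewrite -[in X in has_cyc3 _ _ _ X]tp !permK => /has_cyc3_rot.
have [xv|xv] := eqVneq x v.
  rewrite -xv in uzv; have := key _ _ xyu uzv yz.
  by move/has_cyc3_flip/has_cyc3_rot/has_cyc3_rot.
have [yv|yv] := eqVneq y v; last exact: (step x y z u v).
rewrite -yv in uzv; apply: key uzv xz.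
exact/has_cyc3_rot/has_cyc3_rot/has_cyc3_flip.
Qed.

End ThreeCycles.

(** * Supports of commutators, Bochert's bound, minimal degree of 2-transitive groups *)

Section PrimitiveGroups.

Local Open Scope group_scope.

Variable T : finType.
Implicit Types (a b c d x y : T) (s g k : {perm T}) (G H : {group {perm T}}).

Definition psupp s := [set x | s x != x].

Lemma psuppPn s x : reflect (s x = x) (x \notin psupp s).
Proof. by rewrite inE negbK; apply: eqP. Qed.

Lemma psupp_eq0 s : (psupp s == set0) = (s == 1).
Proof.
apply/eqP/eqP => [s0|->]; last by apply/setP=> x; rewrite !inE perm1 eqxx.
by apply/permP=> x; rewrite perm1; apply/psuppPn; rewrite s0 inE.
Qed.

Lemma psuppV s : psupp s^-1 = psupp s.
Proof.
apply/setP=> x; rewrite !inE; congr (~~ _).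
by rewrite -(inj_eq (@perm_inj _ s)) permKV eq_sym.
Qed.

Lemma psupp_act s x : (s x \in psupp s) = (x \in psupp s).
Proof. by rewrite !inE (inj_eq perm_inj). Qed.

Lemma psuppJ s g : psupp (s ^ g) = g @: psupp s.
Proof.
apply/setP=> x; rewrite -[x](permKV g) mem_imset; last exact: perm_inj.
by rewrite !inE permJ (inj_eq perm_inj).
Qed.

Lemma commgE g k x : [~ g, k] x = k (g (k^-1 (g^-1 x))).
Proof. by rewrite !permM. Qed.

(** The commutator applies g^-1, k^-1, g, k in turn. If g moves x while k fixes both x and g^-1 x,
    the point returns to x; the same holds with the roles of g and k exchanged. *)
Lemma psupp_commg g k (A := psupp g :&: psupp k) :
  psupp [~ g, k] \subset A :|: g @: A :|: k @: A.
Proof.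
apply/subsetP=> x; apply: contraLR; rewrite !in_setU !negb_or -andbA.
case/and3P=> xA xgA xkA; apply/psuppPn; rewrite commgE.
have fixV s y : y \notin psupp s -> s^-1 y = y.
  by move=> sy; apply/psuppPn; rewrite psuppV.
have imA s y : y \notin s @: A -> s^-1 y \notin A.
  by apply: contra => yA; rewrite -[y](permKV s) imset_f.
have [xg|xg] := boolP (x \in psupp g).
  have yg : g^-1 x \in psupp g by rewrite -psuppV psupp_act psuppV.
  have yk : g^-1 x \notin psupp k by have := imA _ _ xgA; rewrite inE yg.
  by rewrite fixV // permKV; apply/psuppPn; move: xA; rewrite inE xg.
rewrite (fixV g) //.
have [yk|yk] := boolP (k^-1 x \in psupp k).
  have yg : k^-1 x \notin psupp g by have := imA _ _ xkA; rewrite inE yk andbT.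
  by rewrite (psuppPn _ _ yg) permKV.
have xk : k^-1 x = x by rewrite -{2}[x](permKV k) (psuppPn _ _ yk).
by rewrite xk (psuppPn _ _ xg) -{1}xk permKV.
Qed.

(** The commutator itself is the 3-cycle: [psupp_commg] confines its support to a, g a, k a, and its
    values there follow because k fixes g a and g^-1 a while g fixes k a and k^-1 a. *)
Lemma has_cyc3_commg G g k a : g \in G -> k \in G ->
  psupp g :&: psupp k = [set a] -> has_cyc3 G a (k a) (g a).
Proof.
move=> gG kG gka.
have /setIP[ag ak] : a \in psupp g :&: psupp k by rewrite gka inE.
have disj x : x != a -> x \in psupp g -> x \notin psupp k.
  by move=> xa xg; apply/negP=> xk; case/negP: xa; rewrite -in_set1 -gka inE xg.
have ga : g a != a by move: ag; rewrite inE.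
have ka : k a != a by move: ak; rewrite inE.
have kfix x : x != a -> x \in psupp g -> k x = x /\ k^-1 x = x.
  by move=> xa xg; have xk := disj x xa xg; split; apply/psuppPn; rewrite ?psuppV.
have gfix x : x != a -> x \in psupp k -> g x = x /\ g^-1 x = x.
  move=> xa xk; have xg : x \notin psupp g by apply: contraL xk; apply: disj.
  by split; apply/psuppPn; rewrite ?psuppV.
have [kga kVga] : k (g a) = g a /\ k^-1 (g a) = g a by apply: kfix; rewrite ?psupp_act.
have [gka' gVka] : g (k a) = k a /\ g^-1 (k a) = k a by apply: gfix; rewrite ?psupp_act.
have u : uniq [:: a; k a; g a].
  rewrite /= !inE negb_or andbT eq_sym ka eq_sym ga /=; apply: contraNneq ka => e.
  by rewrite -(inj_eq (@perm_inj _ g)) gka' e.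
suff -> : has_cyc3 G a (k a) (g a) = ([~ g, k] \in G) by rewrite groupR.
rewrite /has_cyc3 u; congr (_ \in G); apply/permP => x.
have [e1 e2 e3] := cyc3E u.
have [->|xa] := eqVneq x a.
  rewrite e1 commgE.
  have [_ ->] : k (g^-1 a) = g^-1 a /\ k^-1 (g^-1 a) = g^-1 a.
    apply: kfix; first by rewrite -(inj_eq (@perm_inj _ g)) permKV eq_sym.
    by rewrite -psuppV psupp_act psuppV.
  by rewrite permKV.
have [->|xk] := eqVneq x (k a); first by rewrite e2 commgE gVka permK.
have [->|xg] := eqVneq x (g a).
  rewrite e3 commgE permK.
  have [-> _] : g (k^-1 a) = k^-1 a /\ g^-1 (k^-1 a) = k^-1 a.
    apply: gfix; first by rewrite -(inj_eq (@perm_inj _ k)) permKV eq_sym.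
    by rewrite -psuppV psupp_act psuppV.
  by rewrite permKV.
rewrite cyc3D //; apply/esym/psuppPn; apply: contra (subsetP (psupp_commg g k) x) _.
by rewrite gka !imset_set1 !inE !negb_or xa xg xk.
Qed.

(* Bochert: if a base of minimal size had more than n/2 points, then neither its
   complement nor the base minus a point would be a base, which gives two elements
   whose supports meet in one point. *)
Lemma primitive_base G :
    [primitive G, on [set: T] | 'P] -> ~~ ('Alt_T \subset G) ->
  exists B : {set T}, (#|B|.*2 <= #|T|)%N /\ G :&: perm.Sym (~: B) = 1.
Proof.
move=> primG nAlt; pose base (B : {set T}) := G :&: perm.Sym (~: B) == 1.
have baseT : base setT.
  rewrite /base setCT -subG1; apply/subsetP=> s; rewrite !inE => /andP[_ s0].
  by rewrite -psupp_eq0 -subset0; apply: subset_trans s0; apply/subsetP=> x; rewrite !inE.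
have [B bB minB] := arg_minnP (fun B : {set T} => #|B|) baseT.
exists B; split; last exact/eqP.
have notbase (C : {set T}) : (#|C| < #|B|)%N ->
    exists s, [/\ s \in G, s != 1 & psupp s \subset ~: C].
  move=> ltCB; have : ~~ base C by apply: contraL ltCB => /minB; rewrite -leqNgt.
  rewrite /base -subG1 => /subsetPn[s /setIP[sG sC] s1].
  exists s; split=> //; first by move: s1; rewrite inE.
  by apply/subsetP=> x; rewrite inE => sx; move: sC; rewrite inE => /subsetP->.
rewrite leqNgt; apply: contra nAlt => big.
have [x [xG x1 xB]] : exists s, [/\ s \in G, s != 1 & psupp s \subset ~: ~: B].
  by apply: notbase; have := cardsC B; lia.
rewrite setCK in xB.
have [a ax] : exists a, a \in psupp x by apply/set0Pn; rewrite psupp_eq0.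
have aB := subsetP xB _ ax.
have [y [yG y1 yB]] : exists s, [/\ s \in G, s != 1 & psupp s \subset ~: (B :\ a)].
  by apply: notbase; rewrite [X in (_ < X)%N](cardsD1 a) aB.
have ay : a \in psupp y.
  apply: contraNT y1 => ay; have /eqP : base B by [].
  move/setP/(_ y); rewrite !inE yG => <- /=; apply/subsetP=> z; rewrite inE => zy.
  have zs : z \in psupp y by rewrite inE.
  have := subsetP yB z zs; rewrite !inE negb_and negbK => /orP[/eqP za|//].
  by rewrite -za zs in ay.
apply: (primitive_cyc3 primG (has_cyc3_commg (a := a) xG yG _)).
apply/eqP; rewrite eqEsubset sub1set in_setI ax ay !andbT; apply/subsetP=> z.
case/setIP=> /(subsetP xB) zB /(subsetP yB); rewrite !inE zB andbT negbK //.
Qed.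

(** [G] meets the symmetric group on the complement of a base trivially, so the products of their
    elements are pairwise distinct; that complement contains at least half of the points. *)
Lemma primitive_card G :
    [primitive G, on [set: T] | 'P] -> ~~ ('Alt_T \subset G) ->
  (#|G| * (uphalf #|T|)`! <= (#|T|)`!)%N.
Proof.
move=> primG nAlt; have [B [leB tiB]] := primitive_base primG nAlt.
have := TI_cardMg (G := G) (H := perm.Sym_group (~: B)) tiB.
rewrite perm.card_Sym => cGS.
have cT : #|{perm T}| = (#|T|)`!.
  rewrite -cardsT -perm.card_Sym; apply: eq_card => s; rewrite !inE.
  by apply/esym/subsetP => x _; rewrite inE.
apply: leq_trans (_ : #|G| * (#|~: B|)`! <= _)%N; last first.
  by rewrite -cGS -cT -cardsT subset_leq_card // subsetT.
rewrite leq_mul2l leq_fact ?orbT //; have := cardsC B; lia.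
Qed.

Definition two_transitive G := [forall x, forall y, forall x', forall y',
  (x != y) ==> (x' != y') ==> [exists s in G, (s x == x') && (s y == y')]].

Lemma two_transitiveP G : reflect
  (forall x y x' y', x != y -> x' != y' -> exists2 s, s \in G & s x = x' /\ s y = y')
  (two_transitive G).
Proof.
apply: (iffP idP) => [tr x y x' y' xy xy'|tr].
  have /implyP/(_ xy)/implyP/(_ xy')/exists_inP[s sG /andP[/eqP ? /eqP ?]] :=
    forallP (forallP (forallP (forallP tr x) y) x') y'.
  by exists s.
apply/forallP=> x; apply/forallP=> y; apply/forallP=> x'; apply/forallP=> y'.
apply/implyP=> xy; apply/implyP=> xy'; have [s sG [<- <-]] := tr _ _ _ _ xy xy'.
by apply/exists_inP; exists s; rewrite ?eqxx.
Qed.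

(** The stabiliser of [a] is transitive on the other points, so each of these sets is a coset of a
    two-point stabiliser, whose order is given by the orbit formula. *)
Lemma two_transitive_count G a b : two_transitive G -> b != a ->
  exists2 M, (0 < M)%N & forall x y, x != a -> y != a ->
    #|[set h in 'C_G[a | 'P] | h x == y]| = M.
Proof.
move=> /two_transitiveP tr ba; pose Ga := 'C_G[a | 'P]%G.
have mv x z : x != a -> z != a -> exists2 h, h \in Ga & h x = z.
  move=> xa za; have [|| h hG [ha hx]] := tr a x a z; rewrite ?[a == _]eq_sym //.
  by exists h => //; rewrite inE hG; apply/astab1P.
have orb x : x != a -> orbit 'P Ga x = [set~ a].
  move=> xa; apply/setP=> z; rewrite !inE; apply/orbitP/idP=> [[h]|za].
    case/setIP=> _ /astab1P /= ha <-; rewrite apermE.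
    by apply: contra xa => /eqP e; rewrite -(inj_eq (@perm_inj _ h)) e -{1}ha.
  by have [h hG hx] := mv x z xa za; exists h.
have stab x : x != a -> #|'C_Ga[x | 'P]| = #|'C_Ga[b | 'P]|.
  move=> xa; have := card_orbit_stab 'P Ga x; rewrite -(card_orbit_stab 'P Ga b).
  rewrite !orb // => /eqP; rewrite eqn_pmul2l => [/eqP//|].
  by apply/card_gt0P; exists b; rewrite !inE.
exists #|'C_Ga[b | 'P]|; first exact: cardG_gt0.
move=> x y xa ya; rewrite -(stab x xa); have [h hG <-] := mv x y xa ya.
rewrite -[RHS](card_rcoset _ h) -(amove_act 'P x (subsetT _) hG); apply: eq_card => z.
by rewrite [RHS]inE /= !inE /= !apermE.
Qed.

(* Let g have minimal support D and move a to b. Averaging over the h fixing a with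
   h b outside D gives a conjugate g ^ h that does not commute with g and whose
   support meets D in few points besides a. The support of the commutator is then
   smaller than D, unless the two supports meet only in a. *)
Lemma two_transitive_psupp G g :
    [primitive G, on [set: T] | 'P] -> two_transitive G ->
  g \in G -> g != 1 -> (10 * #|psupp g| <= #|T|)%N -> 'Alt_T \subset G.
Proof.
move=> primG tr gG g1 small; pose P := [pred s | (s \in G) && (s != 1)].
have Pg : P g by rewrite /= gG.
have [f /andP[fG f1] minf] := arg_minnP (fun s : {perm T} => #|psupp s|) Pg.
have {}small : (10 * #|psupp f| <= #|T|)%N.
  by apply: leq_trans small; rewrite leq_mul2l minf.
move: {g gG g1 Pg} f fG f1 minf small => g gG g1 ming small.
have [a aD] : exists a, a \in psupp g by apply/set0Pn; rewrite psupp_eq0.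
set D := psupp g in aD small ming; pose b := g a.
have ba : b != a by move: aD; rewrite inE.
have bD : b \in D by rewrite psupp_act.
have [M M0 cM] := two_transitive_count tr ba; pose Ga := 'C_G[a | 'P]%G.
have GaP h : h \in Ga -> h \in G /\ h a = a by case/setIP=> ? /astab1P.
pose O (h : {perm T}) := #|[set x in D :\ a | h x \in D]|.
have cDa : #|D| = (#|D :\ a|).+1 by rewrite (cardsD1 a) aD.
have Da x : x \in D :\ a -> x != a by case/setD1P.
(* Double counting of the triples (h, x, y) with h x = y and x, y in [D :\ a]. *)
have sumO : (\sum_(h in Ga) O h = #|D :\ a| ^ 2 * M)%N.
  transitivity (\sum_(h in Ga) \sum_(x in D :\ a) \sum_(y in D :\ a) (h x == y))%N.
    apply: eq_bigr => h /GaP[_ ha]; rewrite /O -sum1dep_card big_mkcondr /=.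
    apply: eq_bigr => x xD; have hx : h x != a.
      by apply: contra (Da x xD) => /eqP e; rewrite -(inj_eq (@perm_inj _ h)) e ha.
    case: ifP => hxD; last first.
      rewrite big1 // => y /setD1P[_ yD]; case: eqP => // e.
      by rewrite -e hxD in yD.
    rewrite (bigD1 (h x)) /=; last by rewrite in_setD1 hx.
    rewrite eqxx big1 // => y /andP[_].
    by rewrite eq_sym => /negPf->.
  rewrite exchange_big /= -mulnn -mulnA -sum_nat_const; apply: eq_bigr => x xD.
  rewrite exchange_big /= -sum_nat_const; apply: eq_bigr => y yD.
  rewrite -(cM x y) ?Da // -sum1dep_card big_mkcondr /=.
  by apply: eq_bigr => h _; case: eqP.
pose F := [set h in Ga | h b \notin D].
have cF : (#|F| = #|~: D| * M)%N.
  rewrite -sum1dep_card big_mkcondr /=.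
  transitivity (\sum_(h in Ga) \sum_(y in ~: D) (h b == y))%N.
    apply: eq_bigr => h _; case: ifPn => hb; last first.
      rewrite big1 // => y; rewrite inE => yD; case: eqP => // e.
      by rewrite -e in yD; rewrite yD in hb.
    rewrite (bigD1 (h b)) /=; last by rewrite in_setC.
    rewrite eqxx big1 // => y /andP[_].
    by rewrite eq_sym => /negPf->.
  rewrite exchange_big /= -sum_nat_const; apply: eq_bigr => y yD.
  have ya : y != a by apply: contraTneq yD => ->; rewrite inE negbK.
  rewrite -(cM b y) // -sum1dep_card big_mkcondr /=.
  by apply: eq_bigr => h _; case: eqP.
(* Otherwise the sum of [O h] over [F] alone would exceed [sumO]. *)
have [h hF leO] : exists2 h, h \in F & (O h * #|~: D| <= #|D :\ a| ^ 2)%N.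
  apply/exists_inP; apply: contraT => /exists_inPn /= noh.
  have : (\sum_(h in F) (#|D :\ a| ^ 2).+1 <= \sum_(h in Ga) O h * #|~: D|)%N.
    rewrite [X in (_ <= X)%N](bigID (mem F)) /=; apply: leq_trans (leq_addr _ _).
    rewrite [X in (_ <= X)%N](eq_bigl (mem F)) => [|h]; last first.
      by rewrite andbC -[RHS]/(h \in F) andb_idr // inE => /andP[].
    by apply: leq_sum => h /noh; rewrite ltnNge.
  rewrite sum_nat_const -big_distrl /= sumO cF; have := cardsC D.
  by move: small cDa M0; clear; nia.
have {hF} [hGa hb] : h \in Ga /\ h b \notin D by move: hF; rewrite inE => /andP.
have [hG ha] := GaP h hGa; pose k := g ^ h.
have kG : k \in G by rewrite groupJ.
have ka : k a = h b by rewrite -{1}ha permJ.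
have cap : D :&: psupp k = a |: h @: [set x in D :\ a | h x \in D].
  apply/setP=> x; rewrite psuppJ -[x](permKV h); move: (h^-1 x) => {}x.
  rewrite !inE !mem_imset ?inE; try exact: perm_inj.
  rewrite -[X in h x == X]ha (inj_eq perm_inj); have [->|xa] := eqVneq x a.
    by rewrite /= ha; move: aD; rewrite inE => ->.
  by rewrite /= andbC.
(* [g] fixes [k a = h b], which lies outside [D]; if [g] and [k] commuted, then k (g a) = k a and
   [g] would fix [a]. *)
have c1 : [~ g, k] != 1.
  apply/negP => /commgP cgk; move: hb; rewrite -ka => /psuppPn gka.
  by case/eqP: ba; apply: (@perm_inj _ k); rewrite -permM cgk permM.
have leD : (#|D| <= 3 * (O h).+1)%N.
  have := ming [~ g, k]; rewrite /= groupR // c1 => /(_ isT) /leq_trans; apply.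
  apply: leq_trans (subset_leq_card (psupp_commg g k)) _.
  have cA : (#|D :&: psupp k| <= (O h).+1)%N.
    by rewrite cap cardsU1 -add1n leq_add ?leq_b1 ?leq_imset_card.
  apply: leq_trans (leq_card_setU _ _) _.
  apply: leq_trans (leq_add (leq_card_setU _ _) (leqnn _)) _.
  rewrite -/D !card_imset; [|exact: perm_inj..].
  by rewrite !mulSn mul0n addn0 addnA !leq_add.
(* The constant 10 makes the complement of [D] at least 9 times as large as [D], so [leO] gives 9 O
   < #|D| <= 3 O + 3, which forces O = 0. *)
have O0 : O h = 0 by have := cardsC D; move: small cDa leO leD; clear; nia.
apply: (primitive_cyc3 primG (has_cyc3_commg gG kG (a := a) _)).
by rewrite cap (cards0_eq O0) imset0 setU0.
Qed.

End PrimitiveGroups.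

(** * Automorphism groups of binary relations *)

Section Relations.

Local Open Scope group_scope.

Variable T : finType.
Implicit Types (x y : T) (s p : {perm T}) (E : {set T * T}) (G : {group {perm T}}).

Definition aut_rel E : {set {perm T}} :=
  [set s : {perm T} | [forall u, ((s u.1, s u.2) \in E) == (u \in E)]].

Lemma aut_relP E s :
  reflect (forall x y, ((s x, s y) \in E) = ((x, y) \in E)) (s \in aut_rel E).
Proof.
rewrite inE; apply: (iffP forallP) => [h x y|h [x y]]; first exact/eqP/(h (x, y)).
exact/eqP/h.
Qed.

Lemma aut_rel_group_set E : group_set (aut_rel E).
Proof.
apply/group_setP; split; first by apply/aut_relP=> x y; rewrite !perm1.
by move=> s t /aut_relP hs /aut_relP ht; apply/aut_relP=> x y; rewrite !permM ht hs.
Qed.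
Canonical aut_rel_group E := Group (aut_rel_group_set E).

(* E is an orbital of G. *)
Lemma not_two_transitive_rel G : (3 < #|T|)%N -> ~~ two_transitive G ->
  exists E : {set T * T}, G \subset aut_rel E /\ ~~ ('Alt_T \subset aut_rel E).
Proof.
move=> T4 /forallPn[x /forallPn[y /forallPn[x' /forallPn[y']]]].
rewrite negb_imply => /andP[xy]; rewrite negb_imply => /andP[xy' noG].
pose E := [set (s x, s y) | s : {perm T} in G]; exists E; split.
  apply/subsetP=> s sG; apply/aut_relP=> u v; apply/imsetP/imsetP => [][t tG [eu ev]].
    exists (t * s^-1); first by rewrite groupM ?groupV.
    by rewrite !permM -eu -ev !permK.
  by exists (t * s); rewrite ?groupM // !permM eu ev.
apply/negP => sAE.
pose t1 := tperm x x'; pose t2 := tperm (t1 y) y'.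
have t1y : x' != t1 y by rewrite -(tpermL x x') (inj_eq perm_inj).
have tx : (t1 * t2) x = x' by rewrite permM tpermL tpermD 1?eq_sym // eq_sym.
have ty : (t1 * t2) y = y' by rewrite permM tpermL.
(* The parity is corrected by a transposition of two points other than x' and y', whence the need
   for at least four points. *)
have [s [sx sy]] : exists s : {perm T}, [/\ s x = x', s y = y' & s \in 'Alt_T].
  have [odd|ev] := boolP (odd_perm (t1 * t2)); last first.
    by exists (t1 * t2); rewrite Alt_even.
  have /card_gt1P[u [v [uC vC uv]]] : (1 < #|~: [set x'; y']|)%N.
    by have := cardsC [set x'; y']; rewrite cards2 xy'; lia.
  move: uC vC; rewrite !inE !negb_or => /andP[ux uy] /andP[vx vy].
  exists (t1 * t2 * tperm u v); rewrite Alt_even odd_permM odd odd_tperm uv /=.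
  by rewrite [_ x]permM [_ y]permM tx ty !tpermD.
move/(subsetP sAE)/aut_relP/(_ x y); rewrite sx sy.
have -> : (x, y) \in E by apply/imsetP; exists 1; rewrite ?group1 // !perm1.
case/imsetP => g gG [ex ey]; case/negP: noG; apply/exists_inP.
by exists g; rewrite // -ex -ey !eqxx.
Qed.

(* A relation invariant under p is determined by its trace on any set meeting all
   the orbits of p on pairs, and its automorphism group obeys Bochert's bound. *)
Lemma card_not_two_transitive p (D : {set T * T}) : (3 < #|T|)%N ->
    (forall x y, exists i, ((p ^+ i) x, (p ^+ i) y) \in D) ->
  (#|[set s : {perm T} | [exists G : {group {perm T}},
       [&& p \in G, s \in G, [primitive G, on [set: T] | 'P],
           ~~ ('Alt_T \subset G) & ~~ two_transitive G]]]| * (uphalf #|T|)`!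
     <= 2 ^ #|D| * (#|T|)`!)%N.
Proof.
move=> T4 hD; set A := [set s | _].
pose Q := [set E | [&& p \in aut_rel E, [primitive aut_rel E, on [set: T] | 'P]
                     & ~~ ('Alt_T \subset aut_rel E)]].
have leQ : (#|Q| <= 2 ^ #|D|)%N.
  rewrite -card_powerset -(card_in_imset (f := fun E => E :&: D)) => [|E F].
    by apply/subset_leq_card/subsetP=> _ /imsetP[E _ ->]; rewrite inE subsetIr.
  rewrite !inE => /andP[pE _] /andP[pF _] EF; apply/setP=> -[x y].
  have [i iD] := hD x y.
  have /aut_relP <- : p ^+ i \in aut_rel E by rewrite groupX // inE.
  have /aut_relP <- : p ^+ i \in aut_rel F by rewrite groupX // inE.
  by move/setP/(_ ((p ^+ i) x, (p ^+ i) y)): EF; rewrite !in_setI iD !andbT.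
have sub : A \subset \bigcup_(E in Q) aut_rel E.
  apply/subsetP=> s; rewrite inE => /existsP[G /and5P[pG sG prG nAG ntG]].
  have [E [GE nAE]] := not_two_transitive_rel T4 ntG.
  apply/bigcupP; exists E; last exact: (subsetP GE).
  rewrite inE nAE andbT (subsetP GE) //=; exact: primitiveS GE prG.
apply: leq_trans (leq_mul (subset_leq_card sub) (leqnn _)) _.
apply: leq_trans (leq_mul (card_bigcup_le _ _) (leqnn _)) _.
rewrite big_distrl /=; apply: leq_trans (_ : \sum_(E in Q) (#|T|)`! <= _)%N; last first.
  by rewrite sum_nat_const leq_mul2r leQ orbT.
apply: leq_sum => E; rewrite inE => /and3P[_ prE nAE].
exact: (primitive_card (G := aut_rel_group E)).
Qed.

End Relations.

(** * Long and short cycles *)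

Section Orbits.

Local Open Scope group_scope.

Variables (T : finType) (L : nat).
Implicit Types (x y : T) (s t : {perm T}).

Definition nlong s := #|[set C in porbits s | L < #|C|]|.

Definition short_set s := [set x | #|porbit s x| <= L].

Definition long_prod s := (\prod_(C in porbits s | L < #|C|) #|C|)%N.

Definition dvd_long s := [forall C in porbits s, #|C| %| long_prod s].

Lemma card_porbit_gt0 s x : 0 < #|porbit s x|.
Proof. by rewrite lt0n card_porbit_neq0. Qed.

Lemma long_prod_gt0 s : 0 < long_prod s.
Proof. by apply: prodn_cond_gt0 => C /andP[/imsetP[x _ ->] _]; exact: card_porbit_gt0. Qed.

Lemma card_short s : #|short_set s| <= #|porbits s| * L.
Proof.
have sub : short_set s \subset \bigcup_(C in porbits s | #|C| <= L) C.
  apply/subsetP => x; rewrite inE => xL; apply/bigcupP.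
  by exists (porbit s x); rewrite ?porbit_id // imset_f.
apply: leq_trans (subset_leq_card sub) _.
apply: leq_trans (card_bigcup_le _ _) _; rewrite -sum_nat_const [leqRHS]big_mkcond big_mkcondr /=.
rewrite [leqLHS]big_mkcond; apply: leq_sum => C _.
by case: ifP => // _; case: ifP.
Qed.

Lemma porbit_in_short s x y : y \in porbit s x -> (y \in short_set s) = (x \in short_set s).
Proof. by rewrite -eq_porbit_mem !inE => /eqP->. Qed.

(** If x lies on a long cycle, rotate the pair until x becomes the representative of its cycle:
    [nlong s] choices, times any second point. If x is short, rotate until y becomes a
    representative; x then ranges over the few short points. *)
Lemma pair_transversal s : exists D : {set T * T},
  #|D| <= nlong s * #|T| + #|porbits s| * (#|porbits s| * L) /\
  forall x y, exists i, ((s ^+ i) x, (s ^+ i) y) \in D.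
Proof.
pose rep (C : {set T}) x := odflt x [pick y in C].
pose r x := rep (porbit s x) x.
have rP x : r x \in porbit s x.
  by rewrite /r /rep; case: pickP => //= _; apply: porbit_id.
have rE x y : porbit s x = porbit s y -> r x = r y.
  rewrite /r => exy; rewrite exy /rep; case: pickP => // n0.
  by have := n0 y; rewrite porbit_id.
have card_rep (A : {set T}) : #|r @: A| <= #|[set porbit s x | x in A]|.
  have [->|[x0 _]] := set_0Vmem A; first by rewrite !imset0 cards0.
  apply: leq_trans (leq_imset_card (fun C => rep C x0) _); apply/subset_leq_card.
  apply/subsetP=> _ /imsetP[x xA ->]; apply/imsetP; exists (porbit s x); first exact: imset_f.
  by rewrite /r /rep; case: pickP => // n0; have := n0 x; rewrite porbit_id.
exists (setX (r @: ~: short_set s) setT :|: setX (short_set s) (r @: setT)); split.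
  apply: leq_trans (leq_card_setU _ _) _; rewrite !cardsX cardsT; apply: leq_add.
    rewrite leq_mul2r; apply/orP; right; apply: leq_trans (card_rep _) _.
    apply/subset_leq_card/subsetP => _ /imsetP[x xS ->]; rewrite inE imset_f //=.
    by move: xS; rewrite !inE -ltnNge.
  rewrite mulnC leq_mul ?card_short //.
  apply: leq_trans (card_rep _) _; apply/subset_leq_card/subsetP => _ /imsetP[x _ ->].
  exact: imset_f.
move=> x y; have [xS|xS] := boolP (x \in short_set s).
  have /porbitP[i ri] := rP y; exists i; rewrite in_setU; apply/orP; right.
  by rewrite in_setX /= -ri imset_f // andbT inE porbit_perm; move: xS; rewrite inE.
have /porbitP[i ri] := rP x; exists i; rewrite in_setU; apply/orP; left.
by rewrite in_setX /= inE andbT -ri imset_f // inE.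
Qed.

Lemma expg_fix_dvd s x m : (s ^+ m) x = x -> #|porbit s x| %| m.
Proof.
move=> sm; set l := #|porbit s x|; have l0 : 0 < l := card_porbit_gt0 s x.
have sl q : (s ^+ (q * l)) x = x.
  by rewrite mulnC expgM permX_fix // permX iter_porbit.
have sr : (s ^+ (m %% l)) x = x.
  by rewrite -{2}sm {2}(divn_eq m l) expgD permM sl.
have ltr : m %% l < l by rewrite ltn_pmod.
have := uniq_traject_porbit s x; rewrite -/l => /(nth_uniq x).
move=> /(_ (m %% l) 0); rewrite size_traject ltr l0 => /(_ isT isT).
by rewrite !nth_traject // -permX sr eqxx /dvdn => <-.
Qed.

Lemma psupp_long_prod s : psupp (s ^+ long_prod s) \subset short_set s.
Proof.
apply/subsetP=> x; apply: contraLR; rewrite inE -ltnNge => xL.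
apply/psuppPn; have /dvdnP[q ->] : #|porbit s x| %| long_prod s.
  by rewrite /long_prod (bigD1 (porbit s x)) ?imset_f //= dvdn_mulr.
by rewrite mulnC expgM permX_fix // permX iter_porbit.
Qed.

Lemma dvd_long_expg s : s ^+ long_prod s = 1 -> dvd_long s.
Proof.
move=> s1; apply/forall_inP => _ /imsetP[x _ ->]; apply: expg_fix_dvd.
by rewrite s1 perm1.
Qed.

Lemma two_transitive_dvd_long (G : {group {perm T}}) s : s \in G ->
    [primitive G, on [set: T] | 'P] -> ~~ ('Alt_T \subset G) -> two_transitive G ->
    10 * (#|porbits s| * L) <= #|T| ->
  dvd_long s.
Proof.
move=> sG primG nAlt trG small; apply/dvd_long_expg/eqP; apply: contraR nAlt => s1.
apply: (two_transitive_psupp primG trG _ s1); first by rewrite groupX.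
apply: leq_trans small; rewrite leq_mul2l; apply: leq_trans (card_short s).
exact/subset_leq_card/psupp_long_prod.
Qed.

Lemma porbit_agree (U : {set T}) s t x :
    (forall y, y \in U -> s y \in U) -> (forall y, y \in U -> t y = s y) ->
  x \in U -> porbit t x = porbit s x.
Proof.
move=> Us ts xU.
have [eqX inU] : (forall i, (t ^+ i) x = (s ^+ i) x) /\ forall i, (s ^+ i) x \in U.
  have inU i : (s ^+ i) x \in U.
    by elim: i => [|i IH]; rewrite ?perm1 // expgSr permM Us.
  split=> //; elim=> [|i IH]; first by rewrite !perm1.
  by rewrite !expgSr !permM IH ts.
by apply/setP=> y; apply/porbitP/porbitP=> -[i ->]; exists i.
Qed.

End Orbits.

Import Order.TTheory GRing.Theory Num.Theory.
Local Open Scope ring_scope.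

(** * Cycle statistics *)

Section Insertion.

Variable T : finType.
Implicit Types (x y z : T) (S C : {set T}) (s t : {perm T}).

(* When s fixes x, the permutation tperm x y * s is s with x inserted after y. *)
Lemma porbit_insert_out s x y z : s x = x -> z \notin x |: porbit s y ->
  porbit (tperm x y * s)%g z = porbit s z.
Proof.
rewrite in_setU1 negb_or => sx /andP[zx zy].
have sXx i : (s ^+ i)%g x = x by exact: permX_fix.
have eqX i : ((tperm x y * s) ^+ i)%g z = (s ^+ i)%g z.
  elim: i => [|i IH]; first by rewrite !expg0.
  rewrite !expgSr !permM IH tpermD //.
    by rewrite -{1}(sXx i) (inj_eq perm_inj) eq_sym.
  by apply: contra zy => /eqP->; rewrite porbit_sym mem_porbit.
by apply/setP => w; apply/porbitP/porbitP => -[i ->]; exists i.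
Qed.

Lemma porbit_insert s x y : s x = x -> y != x ->
  porbit (tperm x y * s)%g x = x |: porbit s y.
Proof.
move=> sx yx; set t := (tperm x y * s)%g.
have sXx i : (s ^+ i)%g x = x by exact: permX_fix.
have tC z w : z \in porbit t w -> t z \in porbit t w.
  by case/porbitP=> i ->; rewrite -permM -expgSr mem_porbit.
have yt : y \in porbit t x.
  by rewrite porbit_sym -[X in X \in _](_ : t y = x) ?tC ?porbit_id // permM tpermR.
apply/setP=> w; apply/idP/idP => [wt|].
  apply: contraT => nw; have := porbit_insert_out sx nw; rewrite -/t => e.
  have : x \in porbit s w by rewrite -e porbit_sym.
  case/porbitP=> i; rewrite -{1}(sXx i) => /perm_inj exw.
  by rewrite -exw setU11 in nw.
case/setU1P=> [->|/porbitP[i ->]]; first exact: porbit_id.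
elim: i => [|i IH]; first by rewrite perm1.
rewrite expgSr permM; set u := (s ^+ i)%g y in IH *.
have ux : u != x by rewrite -(sXx i) (inj_eq perm_inj).
have [->|uy] := eqVneq u y; last first.
  by have := tC _ _ IH; rewrite permM tpermD // eq_sym.
by have := tC _ _ (porbit_id t x); rewrite permM tpermL.
Qed.

Lemma porbits_insert s x y C : s x = x -> y != x ->
  (C \in porbits (tperm x y * s)%g) && (x \notin C) =
  [&& C \in porbits s, x \notin C & y \notin C].
Proof.
move=> sx yx; set t := (tperm x y * s)%g.
have out z : z \notin porbit t x -> porbit t z = porbit s z.
  by rewrite porbit_insert // => /porbit_insert_out->.
apply/andP/and3P => [[/imsetP[z _ ->] xz]|[/imsetP[z _ ->] xz yz]].
  have zx : z \notin porbit t x by rewrite porbit_sym.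
  split=> //; first by rewrite out // imset_f.
  rewrite out //; apply: contra zx => zy; rewrite porbit_insert //.
  by rewrite in_setU1 porbit_sym zy orbT.
have zx : z \notin porbit t x.
  rewrite porbit_insert // in_setU1 negb_or [z \in _]porbit_sym yz andbT.
  by apply: contra xz => /eqP ->; exact: porbit_id.
by rewrite -out // imset_f // porbit_sym.
Qed.

Lemma porbit_fix s x : s x = x -> porbit s x = [set x].
Proof.
move=> sx; apply/setP=> z; rewrite inE; apply/porbitP/eqP=> [[i ->]|->].
  exact: permX_fix.
by exists 0; rewrite perm1.
Qed.

Lemma porbit_perm_on S s x : perm_on S s -> x \in S -> porbit s x \subset S.
Proof.
move=> sS xS; apply/subsetP=> z /porbitP[i ->]; elim: i => [|i IH].
  by rewrite perm1.
by rewrite expgSr permM perm_closed.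
Qed.

(** Each permutation of [S] factors uniquely as [tperm x y * s] with s fixing x: necessarily y is
    the preimage of x. The choice y = x accounts for the permutations fixing x. *)
Lemma big_perm_on_insert (R : nmodType) (F : {perm T} -> R) S x : x \in S ->
  \sum_(s | perm_on S s) F s =
  \sum_(y in S) \sum_(s | perm_on (S :\ x) s) F (tperm x y * s)%g.
Proof.
move=> xS; rewrite pair_big_dep /=.
rewrite (reindex_onto (fun u : T * {perm T} => (tperm x u.1 * u.2)%g)
  (fun s => (s^-1%g x, (tperm x (s^-1%g x) * s)%g))) /=; last first.
  by move=> s sS; rewrite tpermKg.
apply: eq_bigl => -[y s] /=; apply/andP/andP => [[tS /eqP[ey es]]|[yS sS]].
  have yS : y \in S by rewrite -ey perm_closed // perm_onV.
  split=> //; have ss : s = (tperm x y * (tperm x y * s))%g by rewrite tpermKg.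
  apply/subsetP=> z; rewrite !inE => sz; apply/andP; split.
    apply: contra sz => /eqP->; rewrite ss permM tpermL -{2}ey; apply/eqP.
    by rewrite ey -{2}ey permKV.
  apply: contraR sz => zS; apply/eqP.
  rewrite ss permM tpermD; [exact: (out_perm tS)| |].
    by apply: contraNneq zS => <-.
  by apply: contraNneq zS => <-.
have sS' : perm_on S s by apply: subset_trans sS _; exact: subD1set.
have tS : perm_on S (tperm x y * s)%g.
  apply: perm_onM => //; apply: subset_trans (tperm_on x y) _.
  by apply/subsetP=> z /set2P[]->.
split=> //; have sx : s x = x by apply: (out_perm sS); rewrite !inE eqxx.
have ey : ((tperm x y * s)^-1)%g x = y.
  by apply: (@perm_inj _ (tperm x y * s)%g); rewrite permKV permM tpermR.
by rewrite ey tpermKg.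
Qed.

End Insertion.

(** * The exponential formula for multiplicative cycle weights *)

Section CycleWeights.

Variables (R : numFieldType) (f : nat -> R).

(* The list [z_n; ...; z_0] of the coefficients of exp (sum_l f(l) t^l / l). *)
Fixpoint cycle_coefs n : seq R :=
  if n is m.+1 then
    let zs := cycle_coefs m in
    (\sum_(l < m.+1) f l.+1 * zs`_l) / m.+1%:R :: zs
  else [:: 1].

Definition cycle_coef n := (cycle_coefs n)`_0.

Lemma nth_cycle_coefs n l : (l <= n)%N -> (cycle_coefs n)`_l = cycle_coef (n - l).
Proof.
elim: n l => [|n IH] [|l] //=.
by rewrite ltnS subSS; apply: IH.
Qed.

Lemma cycle_coefS n :
  n.+1%:R * cycle_coef n.+1 = \sum_(l < n.+1) f l.+1 * cycle_coef (n - l).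
Proof.
rewrite {1}/cycle_coef /= mulrC divfK ?pnatr_eq0 //.
by apply: eq_bigr => l _; rewrite nth_cycle_coefs // -ltnS.
Qed.

Variable T : finType.
Implicit Types (x y z : T) (S C : {set T}) (s t : {perm T}).

(** The points outside [S], fixed by every [s] with [perm_on S s], must not contribute factors
    [f 1], so that the total depends on [#|S|] alone. *)
Definition cycle_weight S s := \prod_(C in porbits s | C \subset S) f #|C|.

Definition rest_weight S x s :=
  \prod_(C in porbits s | (C \subset S) && (x \notin C)) f #|C|.

Lemma cycle_weight_rest S x s : x \in S -> perm_on S s ->
  cycle_weight S s = f #|porbit s x| * rest_weight S x s.
Proof.
move=> xS sS; rewrite /cycle_weight (bigD1 (porbit s x)) /=; last first.
  by rewrite imset_f // porbit_perm_on.
congr (_ * _); apply: eq_bigl => C; rewrite -andbA; case: imsetP => //= -[z _ ->].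
by rewrite eq_porbit_mem porbit_sym.
Qed.

(** A separate weight [g] for the cycle of [x] makes the induction work: deleting [x] shortens that
    cycle by one, which shifts [g] and passes the mark to the predecessor of [x]. *)
Definition mark_sum (g : nat -> R) S x :=
  \sum_(s | perm_on S s) g #|porbit s x| * rest_weight S x s.

Lemma mark_sum_insert g S x : x \in S ->
  mark_sum g S x = g 1 * (\sum_(s | perm_on (S :\ x) s) cycle_weight (S :\ x) s)
    + \sum_(y in S :\ x) mark_sum (fun l => g l.+1) (S :\ x) y.
Proof.
move=> xS; rewrite /mark_sum (big_perm_on_insert _ xS) (bigD1 x) //=; congr (_ + _).
  rewrite big_distrr /=; apply: eq_bigr => s sS.
  have sx : s x = x by apply: (out_perm sS); rewrite !inE eqxx.
  rewrite tperm1 mul1g porbit_fix // cards1; congr (_ * _); apply: eq_bigl => C.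
  by rewrite subsetD1.
apply: eq_big => [y|y /andP[yS yx]]; first by rewrite !inE andbC.
apply: eq_bigr => s sS.
have sx : s x = x by apply: (out_perm sS); rewrite !inE eqxx.
have xy : x \notin porbit s y.
  by rewrite porbit_sym porbit_fix // inE.
rewrite porbit_insert // cardsU1 xy; congr (_ * _); apply: eq_bigl => C.
rewrite [_ && (x \notin C)]andbC andbA porbits_insert // subsetD1.
by case: (C \in porbits s); case: (C \subset S); case: (x \in C); case: (y \in C).
Qed.

Lemma sum_cycle_weight0 : \sum_(s | perm_on (set0 : {set T}) s) cycle_weight set0 s = 1.
Proof.
rewrite (big_pred1 1%g) => [|s] /=.
  rewrite /cycle_weight big_pred0 // => C; apply/negP => /andP[/imsetP[z _ ->]].
  by rewrite subset0 => /eqP/setP/(_ z); rewrite porbit_id inE.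
apply/idP/eqP => [s0|->]; last exact: perm_on1.
by apply: (perm_on_id s0); rewrite cards0.
Qed.

(** For n = #|S|, a cycle of length l + 1 through [x] can be chosen in (n-1)! / (n-1-l)! ways and
    leaves n-1-l points. Both halves go through one induction: the first uses the second on [S :\ x]
    when [x] is fixed, and returns it for [S] on taking [g = f]. *)
Lemma mark_sum_eq g S x : x \in S ->
  mark_sum g S x =
    (#|S|.-1)`!%:R * \sum_(l < #|S|) g l.+1 * cycle_coef (#|S|.-1 - l)
  /\ \sum_(s | perm_on S s) cycle_weight S s = (#|S|)`!%:R * cycle_coef #|S|.
Proof.
move En : #|S| => n; elim: n g S x En => [|n IH] g S x En xS.
  by rewrite (cards0_eq En) inE in xS.
have total (D : {set T}) : #|D| = n ->
    \sum_(s | perm_on D s) cycle_weight D s = n`!%:R * cycle_coef n.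
  move=> cD; have [D0|[y yD]] := set_0Vmem D; last by have [] := IH g D y cD yD.
  have n0 : n = 0 by rewrite -cD D0 cards0.
  by rewrite n0 fact0 mul1r D0 sum_cycle_weight0.
have mark h : mark_sum h S x =
    n`!%:R * \sum_(l < n.+1) h l.+1 * cycle_coef (n - l).
  have cSx : #|S :\ x| = n by move: En; rewrite (cardsD1 x) xS => -[].
  rewrite mark_sum_insert // total // big_ord_recl subn0 mulrDr.
  congr (_ + _); first by rewrite mulrCA.
  rewrite (eq_bigr (fun=> n.-1`!%:R *
      \sum_(l < n) h l.+2 * cycle_coef (n.-1 - l))) => [|y yS].
    rewrite sumr_const cSx -mulrnAl.
    case: n {IH En total cSx} => [|n]; first by rewrite !big_ord0 !mulr0.
    rewrite /= factS natrM mulr_natl; congr (_ * _).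
  by have [] := IH (fun l => h l.+1) _ _ cSx yS.
split; first exact: mark.
transitivity (mark_sum f S x).
  by apply: eq_bigr => s sS; rewrite (cycle_weight_rest xS).
by rewrite mark -cycle_coefS factS natrM mulrCA mulrA.
Qed.

Lemma sum_cycle_weight S :
  \sum_(s | perm_on S s) cycle_weight S s = (#|S|)`!%:R * cycle_coef #|S|.
Proof.
have [S0|[x xS]] := set_0Vmem S; last by have [] := mark_sum_eq f xS.
by rewrite S0 cards0 fact0 mul1r sum_cycle_weight0.
Qed.

End CycleWeights.

Section Coefs.

Lemma bernoulli_ineq (F : numDomainType) (d : F) k : 0 <= d -> 1 + k%:R * d <= (1 + d) ^+ k.
Proof.
move=> d0; elim: k => [|k IH]; first by rewrite mul0r addr0 expr0.
rewrite exprS; apply: le_trans (ler_wpM2l _ IH); last by rewrite addr_ge0.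
rewrite -subr_ge0 (_ : _ - _ = k%:R * d ^+ 2); first by rewrite mulr_ge0 ?ler0n ?exprn_ge0.
by rewrite -natr1; ring.
Qed.

Variable R : numFieldType.
Implicit Types (f : nat -> R).

Lemma cycle_coef_ge0 f n : (forall l, 0 <= f l) -> 0 <= cycle_coef f n.
Proof.
move=> f0; have [m] := ubnP n; elim: m n => // m IH [|n] nm; first exact: ler01.
rewrite -(pmulr_rge0 _ (ltr0Sn R n)) cycle_coefS sumr_ge0 // => l _.
by rewrite mulr_ge0 // IH //; lia.
Qed.

Lemma cycle_coefS_rev f n :
  n.+1%:R * cycle_coef f n.+1 = \sum_(m < n.+1) f (n - m).+1 * cycle_coef f m.
Proof.
rewrite cycle_coefS [RHS](reindex_inj rev_ord_inj) /=.
apply: eq_bigr => l _; rewrite subSS; congr (f _ * _); have := ltn_ord l; lia.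
Qed.

Lemma cycle_coef_le_sum f n a : (forall l, 0 <= f l <= a) ->
  n.+1%:R * cycle_coef f n.+1 <= a * \sum_(m < n.+1) cycle_coef f m.
Proof.
move=> fa; rewrite cycle_coefS_rev mulr_sumr ler_sum // => m _.
rewrite ler_wpM2r ?cycle_coef_ge0 //; first by move=> l; case/andP: (fa l).
by case/andP: (fa (n - m).+1).
Qed.

Lemma cycle_coef_le1 f n : (forall l, 0 <= f l) ->
  (forall l, (l <= n)%N -> f l <= 1) -> cycle_coef f n <= 1.
Proof.
move=> f0 f1; have [m] := ubnP n; elim: m n f1 => // m IH [|n] f1 nm; first exact: lexx.
rewrite -(ler_pM2l (ltr0Sn R n)) cycle_coefS mulr1.
apply: le_trans (_ : \sum_(l < n.+1) 1 <= _); last by rewrite sumr_const card_ord.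
apply: ler_sum => l _; rewrite -[leRHS]mulr1; apply: ler_pM => //.
- exact: cycle_coef_ge0.
- by apply: f1; have := ltn_ord l; lia.
by apply: IH; [move=> k kn; apply: f1; lia | lia].
Qed.

(* The weight of a permutation is x to the number of its cycles longer than L. *)
Definition long_weight (x L l : nat) : R := if (L < l)%N then x%:R else 1.

(** The partial sums s_m of the coefficients satisfy s_(m+1) <= (1 + x/(m+1)) s_m, and by Bernoulli
    the factor is at most ((m+2)/(m+1))^x. This telescopes down to m = L, where every coefficient is
    at most 1. *)
Lemma cycle_coef_long x L n : (0 < x)%N -> (L < n)%N ->
  cycle_coef (long_weight x L) n <= x%:R * (n%:R / L.+1%:R) ^+ x.-1.
Proof.
move=> x0; set f := long_weight x L.
have f0 l : 0 <= f l <= x%:R.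
  by rewrite /f /long_weight; case: ifP => _; rewrite ?ler0n ?ler01 ?lexx ?ler1n.
have base : \sum_(i < L.+1) cycle_coef f i <= L.+1%:R * (L.+1%:R / L.+1%:R) ^+ x.
  rewrite divff ?pnatr_eq0 // expr1n mulr1.
  apply: le_trans (_ : \sum_(l < L.+1) 1 <= _); last by rewrite sumr_const card_ord.
  apply: ler_sum => i _; apply: cycle_coef_le1 => l; first by case/andP: (f0 l).
  by move=> li; rewrite /f /long_weight ltnNge (leq_trans li) // -ltnS.
have sumL m : (L <= m)%N -> \sum_(i < m.+1) cycle_coef f i <=
    L.+1%:R * (m.+1%:R / L.+1%:R) ^+ x.
  elim: m => [|m IH]; rewrite leq_eqVlt => /predU1P[<-|Lm] //.
  rewrite big_ord_recr /=; have {}IH := IH Lm.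
  have le1 := cycle_coef_le_sum m f0.
  have le2 : cycle_coef f m.+1 <= x%:R / m.+1%:R * \sum_(i < m.+1) cycle_coef f i.
    by rewrite mulrAC ler_pdivlMr ?ltr0Sn // mulrC.
  apply: le_trans (lerD (lexx _) le2) _; rewrite -[X in X + _]mul1r -mulrDl.
  apply: le_trans (ler_wpM2l _ IH) _; first by rewrite addr_ge0 ?divr_ge0 ?ler0n ?ler01.
  have m0 : m.+1%:R != 0 :> R by rewrite pnatr_eq0.
  have -> : m.+2%:R / L.+1%:R = (1 + m.+1%:R^-1) * (m.+1%:R / L.+1%:R) :> R.
    by rewrite [RHS]mulrDl mul1r mulKf // -[X in _ + X]mul1r -mulrDl natr1.
  rewrite [in leRHS]exprMn [leRHS]mulrCA; apply: ler_wpM2r.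
    by rewrite mulr_ge0 ?ler0n // exprn_ge0 // divr_ge0 ?ler0n.
  by apply: bernoulli_ineq; rewrite invr_ge0 ler0n.
case: n => // n Ln; rewrite -(ler_pM2l (ltr0Sn R n)).
apply: le_trans (cycle_coef_le_sum n f0) _.
apply: le_trans (ler_wpM2l (ler0n _ _) (sumL n Ln)) _.
rewrite [leRHS]mulrCA ler_wpM2l ?ler0n //; case: x x0 @f f0 base sumL => // x _ *.
by rewrite exprS /= mulrA [L.+1%:R * _]mulrC divfK // pnatr_eq0.
Qed.

(** In the recursion only indices up to n - L survive. Index 0 contributes 1 and, by induction, each
    other one at most 1/(L+1): in total 1 + (n-L)/(L+1) = (n+1)/(L+1). *)
Lemma cycle_coef_all_long L n :
  cycle_coef (fun l => (L < l)%:R : R) n.+1 <= L.+1%:R^-1.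
Proof.
have [m] := ubnP n; elim: m n => // m IH n nm.
rewrite -(ler_pM2l (ltr0Sn R n)) cycle_coefS_rev -(ler_pM2r (ltr0Sn R L)).
rewrite divfK ?pnatr_eq0 //.
have f0 l : 0 <= (L < l)%:R :> R by [].
have [nL|Ln] := ltnP n L.
  by rewrite big1 ?mul0r // => i _; rewrite ltnS leqNgt (leq_ltn_trans (leq_subr _ _)) ?mul0r.
apply: le_trans (_ : (\sum_(i < (n - L).+1) cycle_coef (fun l => (L < l)%:R : R) i) * L.+1%:R <= _).
  rewrite ler_wpM2r // (big_ord_widen_cond n.+1 xpredT (cycle_coef _)); last by lia.
  rewrite [leRHS]big_mkcond /=; apply: ler_sum => i _; have := ltn_ord i.
  rewrite ltnS => iN; case: ifPn => iL.
    by rewrite -[leRHS]mul1r ler_wpM2r ?cycle_coef_ge0 // lern1 leq_b1.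
  have /negPf-> : ~~ (L < (n - i).+1)%N by lia.
  by rewrite mul0r.
rewrite big_ord_recl mulrDl mul1r.
apply: le_trans (lerD (lexx _) (_ : _ <= (n - L)%:R)) _; last by rewrite -natrD ler_nat; lia.
rewrite -ler_pdivlMr ?ltr0Sn //.
apply: le_trans (_ : \sum_(i < n - L) L.+1%:R^-1 <= _).
  by apply: ler_sum => i _; apply: IH; apply: leq_trans (ltn_ord i) _; lia.
by rewrite sumr_const card_ord [leRHS]mulr_natl.
Qed.

End Coefs.

Section ExpBound.

Import boolp classical_sets topology normedtype derive realfun.
Import numFieldNormedType.Exports.
Local Open Scope classical_set_scope.
Local Open Scope ring_scope.

Variables (R : realType) (f : nat -> R).
Hypothesis f0 : forall l, 0 <= f l.

(* The truncated generating function P of the coefficients satisfies P' <= Q' P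
   with Q = sum_l f(l) t^l / l, so that P exp(-Q) is nonincreasing on [0, 1]. *)
Lemma sum_cycle_coef_le n :
  \sum_(m < n.+1) cycle_coef f m <= expR (\sum_(l < n) f l.+1 / l.+1%:R).
Proof.
pose z := cycle_coef f.
have z0 m : 0 <= z m by exact: cycle_coef_ge0.
pose P := \poly_(m < n.+1) z m.
pose Q := \sum_(l < n) (f l.+1 / l.+1%:R) *: ('X ^+ l.+1) : {poly R}.
have dQ : Q^`() = \poly_(l < n) f l.+1.
  rewrite /Q raddf_sum poly_def /=; apply: eq_bigr => l _.
  rewrite derivZ derivXn /= (_ : _ *+ _ = l.+1%:R *: 'X ^+ l); last by rewrite scaler_nat.
  by rewrite scalerA divfK ?pnatr_eq0.
have P1 : P.[1] = \sum_(m < n.+1) z m.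
  by rewrite horner_poly; apply: eq_bigr => m _; rewrite expr1n mulr1.
have Q1 : Q.[1] = \sum_(l < n) f l.+1 / l.+1%:R.
  rewrite horner_sum; apply: eq_bigr => m _.
  by rewrite hornerZ hornerXn expr1n mulr1.
have P0 : P.[0] = 1 by rewrite horner_coef0 coef_poly.
have Q0 : Q.[0] = 0.
  rewrite horner_sum big1 // => l _; by rewrite hornerZ hornerXn expr0n mulr0.
(* Below degree n the coefficients vanish by [cycle_coefS]; from there on P' has none, and the
   product has nonnegative ones. *)
have coef_ge0 i : 0 <= (Q^`() * P - P^`())`_i.
  rewrite coefB coef_deriv coefM dQ coef_poly.
  have [iln|nli] := ltnP i.+1 n.+1; last first.
    rewrite mul0rn subr0 sumr_ge0 // => j _; rewrite !coef_poly.
    by do 2![case: ifP => _]; rewrite ?mulr0 ?mul0r // mulr_ge0.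
  rewrite -mulr_natl cycle_coefS subr_ge0 le_eqVlt; apply/orP; left; apply/eqP.
  apply: eq_bigr => j _; rewrite !coef_poly.
  by rewrite !ifT //; have := ltn_ord j; lia.
have ge0 x : 0 <= x -> P^`().[x] <= Q^`().[x] * P.[x].
  move=> x0; rewrite -subr_ge0 -hornerM -hornerN -hornerD horner_coef sumr_ge0 // => i _.
  by rewrite mulr_ge0 ?exprn_ge0.
pose G x := P.[x] * expR (- Q).[x].
pose G' x := P.[x] * ((- Q)^`().[x] * expR (- Q).[x]) + expR (- Q).[x] * P^`().[x].
have dG (x : R) : is_derive x (1 : R) G (G' x).
  have dE : is_derive x (1 : R) (expR \o horner (- Q)) ((- Q)^`().[x] * expR (- Q).[x]).
    by rewrite mulrC; apply: is_derive1_comp.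
  exact: (is_deriveM (is_derive_poly P x) dE).
have cG : {within `[0, 1], continuous G}.
  apply: continuous_subspaceT => x; apply: differentiable_continuous.
  by apply/derivable1_diffP; case: (dG x).
have [c] := MVT ltr01 (fun x _ => dG x) cG.
rewrite in_itv /= => /andP[c0 _]; rewrite subr0 mulr1 => GG.
have : G 1 <= G 0.
  rewrite -subr_le0 GG /G' derivN !hornerN mulNr mulrN addrC mulrA [P.[c] * _]mulrC.
  by rewrite [_ * expR _]mulrC -mulrBr mulr_ge0_le0 ?expR_ge0 // subr_le0 ge0 // ltW.
rewrite /G P0 P1 !hornerN Q0 Q1 oppr0 expR0 mulr1.
by rewrite expRN ler_pdivrMr ?expR_gt0 // mul1r.
Qed.

Lemma cycle_coef_le_expR n : (forall l, f l <= 1) ->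
  n.+1%:R * cycle_coef f n.+1 <= expR (\sum_(l < n) f l.+1 / l.+1%:R).
Proof.
move=> f1; apply: le_trans (sum_cycle_coef_le n).
by rewrite -[leRHS]mul1r; apply: cycle_coef_le_sum => l; rewrite f0 f1.
Qed.

End ExpBound.

(** * Smooth numbers *)

Section Smooth.

Definition smooth (s : seq nat) (l : nat) := all (mem s) (primes l).

Lemma smooth_cons p s l : ~~ (p %| l)%N -> smooth (p :: s) l -> smooth s l.
Proof.
move=> npl /allP sl; apply/allP => q ql; have := sl q ql; rewrite /= inE.
case/predU1P => // qp; case/negP: npl; rewrite -qp.
by move: ql; rewrite mem_primes => /and3P[].
Qed.

Lemma smooth_dvd s d l : (0 < l)%N -> (d %| l)%N -> smooth s l -> smooth s d.
Proof.
move=> l0 dl /allP sl; apply/allP => q; rewrite mem_primes => /and3P[pq d0 qd].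
by apply: sl; rewrite mem_primes pq l0 (dvdn_trans qd).
Qed.

Lemma smooth_primes m l : (0 < m)%N -> (l %| m)%N -> smooth (primes m) l.
Proof. by move=> m0 lm; apply: smooth_dvd lm _ => //; apply/allP. Qed.

Variable R : rcfType.

Definition smooth_sum s n : R := \sum_(l < n) (smooth s l.+1)%:R / l.+1%:R.

(* Splitting according to divisibility by p bounds the sum A for p :: s by the sum
   for s plus A / p. *)
Lemma smooth_sum_cons p s n : (1 < p)%N ->
  smooth_sum (p :: s) n <= p%:R / p.-1%:R * smooth_sum s n.
Proof.
move=> p1; have p0 : 0 < p%:R :> R by rewrite ltr0n ltnW.
have p0' : 0 < p.-1%:R :> R by rewrite ltr0n -subn1 subn_gt0.
pose F l : R := (smooth (p :: s) l)%:R / l%:R.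
have F0 l : 0 <= F l by rewrite divr_ge0 ?ler0n.
suff key : smooth_sum (p :: s) n <= smooth_sum s n + p%:R^-1 * smooth_sum (p :: s) n.
  rewrite mulrAC ler_pdivlMr // -subn1 natrB //; last exact: ltnW.
  have := ler_wpM2l (ltW p0) key; rewrite mulrDr mulVKf ?gt_eqF //; lra.
rewrite {1}/smooth_sum (bigID (fun l : 'I_n => p %| l.+1)%N) /= addrC; apply: lerD.
  rewrite [leLHS]big_mkcond; apply: ler_sum => l _; case: ifPn => [npl|_].
    rewrite ler_wpM2r ?invr_ge0 ?ler0n // ler_nat; case E: (smooth (p :: s) _) => //=.
    by rewrite (smooth_cons npl E).
  by rewrite divr_ge0.
rewrite big_mkcond.
pose X (l k : 'I_n) : R := if l.+1 == (p * k.+1)%N then p%:R^-1 * F k.+1 else 0.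
have X0 l k : 0 <= X l k by rewrite /X; case: ifP => // _; rewrite mulr_ge0 // invr_ge0 ltW.
apply: le_trans (_ : \sum_(l < n) \sum_(k < n) X l k <= _).
  apply: ler_sum => l _; case: ifPn => [pl|_]; last by rewrite sumr_ge0.
  have [k ek] := dvdnP pl; have k0 : (0 < k)%N by case: k ek.
  have kn : (k.-1 < n)%N.
    by apply: leq_ltn_trans (ltn_ord l); rewrite -ltnS prednK // ek leq_pmulr // ltnW.
  rewrite (bigD1 (Ordinal kn)) //= -[leLHS]addr0 lerD ?sumr_ge0 //.
  rewrite /X /= prednK // mulnC -ek eqxx /F {2}ek natrM invfM [leLHS]mulrA [leLHS]mulrC.
  rewrite ler_wpM2l ?invr_ge0 ?(ltW p0) // ler_wpM2r ?invr_ge0 ?ler0n // ler_nat.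
  case E: (smooth _ l.+1) => //; rewrite (smooth_dvd _ _ E) //.
  by rewrite ek dvdn_mulr.
rewrite exchange_big /= mulr_sumr; apply: ler_sum => k _.
have [/existsP[l /eqP el]|/existsPn nol] := boolP [exists l : 'I_n, l.+1 == (p * k.+1)%N].
  rewrite (bigD1 l) //= big1 ?addr0 => [|j jl]; last first.
    rewrite /X; case: eqP => // ej; case/eqP: jl; apply: val_inj => /=.
    by apply: succn_inj; rewrite ej.
  by rewrite /X el eqxx.
rewrite big1 => [|l _]; first by rewrite mulr_ge0 ?invr_ge0 ?divr_ge0 ?(ltW p0).
by rewrite /X (negPf (nol l)).
Qed.

(** Iterating [smooth_sum_cons] builds an Euler product; once no prime is left, only l = 1
    contributes. *)
Lemma smooth_sum_prod s n : all (fun p => (1 < p)%N) s ->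
  smooth_sum s n <= \prod_(p <- s) (p%:R / p.-1%:R).
Proof.
elim: s => [_|p s IH /= /andP[p1 s1]].
  rewrite big_nil /smooth_sum; case: n => [|n]; first by rewrite big_ord0.
  rewrite big_ord_recl /= divr1 big1 ?addr0 ?lern1 ?leq_b1 // => l _.
  rewrite /smooth /= (_ : all _ _ = false) ?mul0r //.
  apply/negP => /allP h; have := h (pdiv (lift ord0 l).+1).
  by rewrite mem_primes pdiv_prime // pdiv_dvd => /(_ isT).
rewrite big_cons; apply: le_trans (smooth_sum_cons _ _ p1) _.
by rewrite ler_wpM2l ?divr_ge0 // IH.
Qed.

(** The first element is at least 2k+1, and then (p/(p-1))^2 <= (2k+1)/(2k-1). The next one is at
    least 2k+3, so these bounds telescope. *)
Lemma prod_odd_le k s : (0 < k)%N -> sorted ltn s -> all odd s ->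
    all (fun p => (k.*2 < p)%N) s ->
  (\prod_(p <- s) (p%:R / p.-1%:R)) ^+ 2 <= 1 + (size s).*2%:R / (k.*2.-1)%:R :> R.
Proof.
elim: s k => [|p s IH] k k0 /=.
  by rewrite big_nil mul0r addr0 expr1n.
move=> sps /andP[op os] /andP[kp ks]; rewrite big_cons exprMn.
have ss : sorted ltn s := path_sorted sps.
have ks' : all (fun q => (k.+1.*2 < q)%N) s.
  apply/allP => q qs; have := allP (order_path_min ltn_trans sps) q qs => /= pq.
  have := allP os q qs; lia.
have {IH ks'}IH := IH k.+1 isT ss os ks'.
have q0 : 0 < k.*2.-1%:R :> R by rewrite ltr0n; lia.
have k1 : k.*2.-1%:R = 2 * k%:R - 1 :> R by rewrite -subn1 natrB -?mul2n ?natrM //; lia.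
have k2 : k.+1.*2.-1%:R = 2 * k%:R + 1 :> R.
  by rewrite doubleS /= -mul2n -natr1 natrM.
have le1 : (p%:R / p.-1%:R) ^+ 2 <= 1 + 2 / k.*2.-1%:R :> R.
  case: p kp {op sps} => // q; rewrite ltnS /= => kq.
  have kqR : 2 * k%:R <= q%:R :> R by rewrite -natrM ler_nat; lia.
  have q1 : 0 < q%:R :> R by rewrite ltr0n; lia.
  rewrite -[X in X + _](divff (lt0r_neq0 q0)) -mulrDl expr_div_n.
  rewrite ler_pdivrMr ?exprn_gt0 // mulrAC ler_pdivlMr //.
  by rewrite k1 -[q.+1%:R]natr1; move: k1 q0 => -> q0; nra.
apply: le_trans (ler_pM _ _ le1 IH) _; rewrite ?exprn_ge0 //.
  by rewrite divr_ge0 ?ler0n.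
  by apply: prodr_ge0 => q _; rewrite divr_ge0 ?ler0n.
rewrite k1 k2 doubleS -addn2 natrD le_eqVlt; apply/orP; left; apply/eqP; field.
by rewrite -k1 lt0r_neq0 //= -k2 pnatr_eq0; lia.
Qed.

(** The smallest prime, possibly 2, contributes a factor at most 2; the others are odd and exceed 2,
    so [prod_odd_le] applies with k = 1. *)
Lemma smooth_sum_le m n :
  smooth_sum (primes m) n <= 2 * Num.sqrt (1 + (size (primes m)).*2%:R).
Proof.
apply: le_trans (smooth_sum_prod _ _) _.
  by apply/allP => p; rewrite mem_primes => /and3P[/prime_gt1].
have : all prime (primes m) by apply/allP => p; rewrite mem_primes => /and3P[].
have := sorted_primes m; case: (primes m) => [_ _|p s ps /= /andP[pp prs]].
  rewrite big_nil addr0 sqrtr1; lra.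
have p1 := prime_gt1 pp.
have os : all odd s.
  apply/allP => q qs; case: (even_prime (allP prs q qs)) => // q2.
  by have := allP (order_path_min ltn_trans ps) q qs => /=; lia.
have gs : all (fun q => (1.*2 < q)%N) s.
  by apply/allP => q qs; have := allP (order_path_min ltn_trans ps) q qs => /=; lia.
have := @prod_odd_le 1 s isT (path_sorted ps) os gs.
set P := \prod_(q <- s) _ => leP; have P0 : 0 <= P.
  by apply: prodr_ge0 => q _; rewrite divr_ge0 ?ler0n.
rewrite big_cons -/P; apply: ler_pM => //; first by rewrite divr_ge0 ?ler0n.
  rewrite ler_pdivrMr ?ltr0n; last lia.
  by rewrite -natrM ler_nat; lia.
rewrite -(ger0_norm P0) -sqrtr_sqr ler_wsqrtr //; apply: le_trans leP _.
by rewrite divr1 lerD2l ler_nat leq_double.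
Qed.

Lemma size_primes_mul a b : (size (primes (a * b)) <= size (primes a) + size (primes b))%N.
Proof.
case: a => [|a]; first by rewrite mul0n.
case: b => [|b]; first by rewrite muln0.
rewrite -size_cat; apply: uniq_leq_size (primes_uniq _) _ => p.
by rewrite primesM // mem_cat.
Qed.

Lemma size_primes_le n : (size (primes n) <= trunc_log 2 n)%N.
Proof.
case: n => // n; have n0 : (0 < n.+1)%N by [].
apply: trunc_log_max => //.
rewrite {2}(prod_prime_decomp n0) prime_decompE big_map /=.
have : all (fun p => (1 < p ^ logn p n.+1)%N) (primes n.+1).
  apply/allP => p; rewrite -logn_gt0 => lp; rewrite -{1}(exp1n (logn p n.+1)).
  by rewrite ltn_exp2r // prime_gt1 //; move: lp; rewrite logn_gt0 mem_primes => /andP[].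
elim: (primes n.+1) => [_|p s IH /= /andP[hp hs]]; first by rewrite big_nil.
by rewrite big_cons expnS leq_mul // IH.
Qed.

End Smooth.

(** * Counting pairs *)

Section Counting.

Variables (R : realType) (T : finType) (L : nat).
Implicit Types (x y : T) (s t : {perm T}) (S U : {set T}).

(** Markov's inequality for [x ^ nlong L s], whose mean is the coefficient bounded in
    [cycle_coef_long]. The base x stays free, to be tuned to the threshold j. *)
Lemma card_nlong_ge (x j : nat) : (0 < x)%N -> (L < #|T|)%N ->
  #|[set s : {perm T} | (j <= nlong L s)%N]|%:R <=
  (#|T|)`!%:R * (x%:R * (#|T|%:R / L.+1%:R) ^+ x.-1 / x%:R ^+ j) :> R.
Proof.
move=> x0 LT; have xj : 0 < x%:R ^+ j :> R by rewrite exprn_gt0 // ltr0n.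
rewrite mulrA ler_pdivlMr //.
apply: le_trans (_ : \sum_(s : {perm T}) (x%:R : R) ^+ nlong L s <= _).
  rewrite -sum1dep_card natr_sum mulr_suml big_mkcond; apply: ler_sum => s _.
  case: ifP => [js|_]; last by rewrite exprn_ge0.
  by rewrite mul1r; case: x x0 {xj} => // x _; rewrite ler_weXn2l // ler1n.
rewrite (_ : \sum_(s : {perm T}) _ =
    \sum_(s | perm_on [set: T] s) cycle_weight (long_weight R x L) setT s).
  by rewrite sum_cycle_weight cardsT ler_wpM2l ?ler0n // cycle_coef_long.
apply: eq_big => [s|s _]; first by apply/esym/subsetP => y _; rewrite inE.
rewrite /cycle_weight /long_weight /nlong.
under eq_bigl do rewrite subsetT andbT.
rewrite -big_mkcondr /= -prodr_const.
by apply: eq_bigl => C; rewrite inE.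
Qed.

Lemma cycle_weight_pred (p : pred nat) S s :
  cycle_weight (fun l => (p l)%:R : R) S s =
  [forall C in porbits s, (C \subset S) ==> p #|C|]%:R.
Proof.
rewrite /cycle_weight; case: (boolP [forall C in _, _]) => [/forall_inP ps|].
  by rewrite big1 // => C /andP[Cs CS]; have := ps C Cs; rewrite CS => /= ->.
case/forall_inPn => C Cs; rewrite negb_imply => /andP[CS /negPf npC].
by rewrite (bigD1 C) ?Cs //= npC mul0r.
Qed.

Lemma card_perm_on_pred (p : pred nat) S :
  #|[set s | perm_on S s & [forall C in porbits s, (C \subset S) ==> p #|C|]]|%:R =
  (#|S|)`!%:R * cycle_coef (fun l => (p l)%:R : R) #|S|.
Proof.
rewrite -sum_cycle_weight -sum1dep_card natr_sum big_mkcondr.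
by apply: eq_bigr => s _; rewrite cycle_weight_pred; case: ifP.
Qed.

Lemma restr_perm_inv U s : (forall x, (s x \in U) = (x \in U)) ->
  perm_on U (restr_perm U s) /\ (forall x, x \in U -> restr_perm U s x = s x).
Proof.
move=> sU; split; first exact: restr_perm_on.
by move=> x xU; rewrite restr_permE //; apply/astabsP.
Qed.

Lemma short_set_inv s x : (s x \in short_set L s) = (x \in short_set L s).
Proof. by apply: porbit_in_short; rewrite -{1}[s]expg1 mem_porbit. Qed.

Lemma porbits_restr_long s C (t := restr_perm (~: short_set L s) s) :
  (C \in porbits t) && (C \subset ~: short_set L s) = (C \in porbits s) && (L < #|C|)%N.
Proof.
have inv x : (s x \in ~: short_set L s) = (x \in ~: short_set L s).
  by rewrite !in_setC short_set_inv.
have [ton tE] := restr_perm_inv inv.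
have same x : x \in ~: short_set L s -> porbit t x = porbit s x.
  by apply: porbit_agree => y; rewrite ?inv //; apply: tE.
apply/andP/andP => [][/imsetP[x _ ->]] => [sub|Lx].
  have xU := subsetP sub _ (porbit_id t x).
  by rewrite same // imset_f //; move: xU; rewrite !inE ltnNge.
have xU : x \in ~: short_set L s by rewrite !inE -ltnNge.
by rewrite -same // imset_f // porbit_perm_on.
Qed.

Variable w : nat.

Definition smooth_bound : R := expR (2 * Num.sqrt (1 + w.*2%:R)).

(** Bounds the proportion of permutations of u points whose cycle lengths have all their primes
    among at most w given ones; the factor 1/u is available only for u > 0. *)
Definition short_bound (u : nat) : R := if u is 0 then 1 else smooth_bound / u%:R.

Definition dvd_long_set :=
  [set s : {perm T} | dvd_long L s & (size (primes (long_prod L s)) <= w)%N].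

(* The permutation t carries the long cycles, so that it determines long_prod s; the
   lengths of the short cycles, which live on U, then have all their prime factors
   among those of a fixed integer. *)
Lemma card_dvd_long_fiber U t :
  #|[set s in dvd_long_set | (short_set L s, restr_perm (~: short_set L s) s) == (U, t)]|%:R
    <= (#|U|)`!%:R * short_bound #|U|.
Proof.
set F := [set s in dvd_long_set | _].
pose M := (\prod_(C in porbits t | C \subset ~: U) #|C|)%N.
have FP s : s \in F ->
    [/\ dvd_long L s, short_set L s = U, restr_perm (~: U) s = t & long_prod L s = M].
  rewrite !inE => /andP[/andP[bs _] /eqP[sU st]]; split=> //; first by rewrite -sU.
  by apply: eq_bigl => C; rewrite -porbits_restr_long st sU.
have E0 : 0 <= smooth_bound := expR_ge0 _.
have rhs0 : 0 <= (#|U|)`!%:R * short_bound #|U|.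
  by rewrite mulr_ge0 // /short_bound; case: #|U| => // u; rewrite divr_ge0.
have [->|[s0 s0F]] := set_0Vmem F; first by rewrite cards0.
have [_ _ _ eM] := FP s0 s0F.
have M0 : (0 < M)%N by rewrite -eM long_prod_gt0.
have wM : (size (primes M) <= w)%N by move: s0F; rewrite -eM !inE => /andP[/andP[]].
have invU s : s \in F -> forall x, (s x \in U) = (x \in U).
  by case/FP => _ <- _ _ x; apply: short_set_inv.
have inj : {in F &, injective (restr_perm U)}.
  move=> s1 s2 F1 F2 e12; apply/permP => x.
  have [_ h1] := restr_perm_inv (invU _ F1); have [_ h2] := restr_perm_inv (invU _ F2).
  have [xU|xU] := boolP (x \in U); first by rewrite -h1 // -h2 // e12.
  have c1 y : (s1 y \in ~: U) = (y \in ~: U) by rewrite !in_setC invU.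
  have c2 y : (s2 y \in ~: U) = (y \in ~: U) by rewrite !in_setC invU.
  have [_ g1] := restr_perm_inv c1; have [_ g2] := restr_perm_inv c2.
  have [_ _ t1 _] := FP _ F1; have [_ _ t2 _] := FP _ F2.
  by rewrite -g1 ?inE // -g2 ?inE // t1 t2.
pose p := smooth (primes M).
apply: le_trans (_ : #|[set s | perm_on U s &
    [forall C in porbits s, (C \subset U) ==> p #|C|]]|%:R <= _).
  rewrite ler_nat -(card_in_imset inj); apply/subset_leq_card/subsetP => _ /imsetP[s sF ->].
  have [r1 r2] := restr_perm_inv (invU _ sF); rewrite inE r1 /=.
  apply/forall_inP => _ /imsetP[x _ ->]; apply/implyP => sub.
  have xU := subsetP sub _ (porbit_id _ x).
  rewrite (porbit_agree (U := U) (s := s)) // => [|y]; last by rewrite invU.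
  have [bs _ _ lM] := FP s sF; rewrite /p -lM; apply: smooth_primes; first exact: long_prod_gt0.
  by apply: (forall_inP bs); apply: imset_f.
rewrite card_perm_on_pred ler_wpM2l //.
have f0 l : 0 <= (p l)%:R :> R by [].
have f1 l : (p l)%:R <= 1 :> R by rewrite lern1 leq_b1.
case: #|U| => [|u]; first exact: lexx.
rewrite /short_bound ler_pdivlMr ?ltr0n // [leLHS]mulrC.
apply: le_trans (cycle_coef_le_expR f0 u f1) _.
rewrite ler_expR; apply: le_trans (smooth_sum_le R M u) _.
by rewrite ler_wpM2l // ler_wsqrtr // lerD2l ler_nat leq_double.
Qed.

Lemma big_set_card (F : nat -> R) :
  \sum_(U : {set T}) F #|U| = \sum_(u < #|T|.+1) 'C(#|T|, u)%:R * F u.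
Proof.
rewrite (partition_big (fun U : {set T} => inord #|U| : 'I_#|T|.+1) xpredT) //=.
apply: eq_bigr => u _; rewrite -card_draws mulr_natl -sumr_const.
have iE (U : {set T}) : (inord #|U| == u) = (#|U| == u).
  by rewrite -val_eqE /= inordK // ltnS max_card.
apply: eq_big => [U|U]; first by rewrite iE inE.
by rewrite iE => /eqP->.
Qed.

(** Summing the fibers over U and t, the binomial and the factorials cancel and leave n! times the
    convolution of [short_bound u] with [y (n - u)], where [y m] is the proportion of permutations
    of m points with all cycles longer than L. It is at most 1/(L+1) for m > 0; the case m = 0, with
    all points short, gives the first summand. *)
Lemma card_dvd_long_le : (0 < #|T|)%N ->
  #|dvd_long_set|%:R <= (#|T|)`!%:R *
    (smooth_bound / #|T|%:R + (1 + smooth_bound * \sum_(u < #|T|) u.+1%:R^-1) / L.+1%:R).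
Proof.
move=> T0; have E0 : 0 <= smooth_bound := expR_ge0 _.
have beta0 u : 0 <= short_bound u by rewrite /short_bound; case: u => // u; rewrite divr_ge0.
pose key s := (short_set L s, restr_perm (~: short_set L s) s).
pose Q (u : {set T} * {perm T}) := perm_on (~: u.1) u.2 &&
  [forall C in porbits u.2, (C \subset ~: u.1) ==> (L < #|C|)%N].
have QB s : s \in dvd_long_set -> Q (key s).
  move=> _; rewrite /Q /= restr_perm_on; apply/forall_inP => C Ct; apply/implyP => CU.
  by have /= := porbits_restr_long s C; rewrite Ct CU => /esym/andP[].
pose y (m : nat) : R := cycle_coef (fun l => (L < l)%:R) m.
have -> : #|dvd_long_set|%:R = \sum_(u | Q u) \sum_(s in dvd_long_set | key s == u) 1 :> R.
  by rewrite -(partition_big key Q) // sumr_const.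
apply: le_trans (_ : \sum_(u | Q u) (#|u.1|)`!%:R * short_bound #|u.1| <= _).
  apply: ler_sum => -[U t] _; apply: le_trans (card_dvd_long_fiber U t); rewrite sumr_const ler_nat.
  by apply/subset_leq_card/subsetP => s su; rewrite inE.
rewrite -(pair_big_dep xpredT (fun U t => Q (U, t))
  (fun U t => (#|U|)`!%:R * short_bound #|U|)) /=.
apply: le_trans (_ : \sum_(U : {set T}) (#|U|)`!%:R * short_bound #|U| *
    ((#|T| - #|U|)`!%:R * y (#|T| - #|U|)%N) <= _).
  apply: ler_sum => U _; rewrite sumr_const -[leLHS]mulr_natr ler_wpM2l ?mulr_ge0 //.
  have -> : (#|T| - #|U|)%N = #|~: U| by have := cardsC U; lia.
  rewrite /y -card_perm_on_pred le_eqVlt; apply/orP; left; apply/eqP; congr (_%:R).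
  by apply: eq_card => t; rewrite inE.
rewrite (big_set_card (fun u => u`!%:R * short_bound u * ((#|T| - u)`!%:R * y (#|T| - u)%N))).
have step (u : 'I_#|T|.+1) : 'C(#|T|, u)%:R * (u`!%:R * short_bound u *
    ((#|T| - u)`!%:R * y (#|T| - u)%N)) = (#|T|)`!%:R * (short_bound u * y (#|T| - u)%N).
  by rewrite -(@bin_fact #|T| u) -1?ltnS // !natrM; ring.
rewrite (eq_bigr _ (fun u _ => step u)) -mulr_sumr ler_wpM2l //.
rewrite big_ord_recr /= subnn addrC; apply: lerD.
  by rewrite /short_bound /y; case: #|T| T0 => // m _; rewrite mulr1.
have y_le (u : 'I_#|T|) : short_bound u * y (#|T| - u)%N <= short_bound u * L.+1%:R^-1.
  rewrite ler_wpM2l // /y; have := ltn_ord u; case D: (#|T| - u)%N => [|m]; first lia.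
  by move=> _; apply: cycle_coef_all_long.
apply: le_trans (ler_sum _ (fun u _ => y_le u)) _.
rewrite -mulr_suml ler_wpM2r ?invr_ge0 //.
case: #|T| => [|m]; first by rewrite !big_ord0 mulr0 addr0.
rewrite big_ord_recl lerD // mulr_sumr big_ord_recr /= lerDl.
by rewrite mulr_ge0 ?invr_ge0.
Qed.

End Counting.

Lemma size_primes_long_prod (T : finType) L (s : {perm T}) :
  (size (primes (long_prod L s)) <= nlong L s * trunc_log 2 #|T|)%N.
Proof.
rewrite /long_prod /nlong -sum_nat_const big_mkcond [leqRHS]big_mkcond /=.
apply: (big_ind2 (fun m k => (size (primes m) <= k)%N)) => //= [m1 k1 m2 k2 h1 h2|C _].
  exact: leq_trans (size_primes_mul _ _) (leq_add h1 h2).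
rewrite inE; case: ifP => // _; apply: leq_trans (size_primes_le _) _.
have [->|C0] := posnP #|C|; first by rewrite trunc_log0.
by apply: trunc_log_max => //; apply: leq_trans (trunc_logP _ C0) (max_card _).
Qed.

Section PairsBound.

Variables (R : realType) (n L c N : nat).
Hypotheses (n3 : (3 < n)%N) (small : (10 * (c * L) <= n)%N).

Definition atypical := [set s : 'S_n | (c < #|porbits s|) || (N < nlong L s)]%N.

Lemma typicalP (s : 'S_n) :
  s \notin atypical -> (#|porbits s| <= c)%N /\ (nlong L s <= N)%N.
Proof. by rewrite inE negb_or -!leqNgt => /andP. Qed.

(** The terms account in turn for pairs with an atypical entry, for typical pairs in a group that is
    not 2-transitive, and for typical pairs in a 2-transitive one. The exponent of 2 bounds the size
    of the set given by [pair_transversal]. *)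
Lemma card_primitive_pairs :
  #|primitive_pairs n|%:R <=
    2 * n`!%:R * #|atypical|%:R
    + n`!%:R * (2 ^+ (N * n + c * (c * L)) * n`!%:R / (uphalf n)`!%:R)
    + #|dvd_long_set 'I_n L (N * trunc_log 2 n)|%:R ^+ 2 :> R.
Proof.
set A := atypical; set Bd := dvd_long_set _ _ _.
pose Us (p : 'S_n) := [set s : 'S_n | [exists G : {group 'S_n},
  [&& p \in G, s \in G, [primitive G, on [set: 'I_n] | 'P],
      ~~ (Alt 'I_n \subset G) & ~~ two_transitive G]]].
pose C := [set ps : 'S_n * 'S_n | ps.1 \notin A & ps.2 \in Us ps.1].
have cS : #|[set: 'S_n]| = n`!.
  by rewrite cardsT card_Sn.
have sub : primitive_pairs n \subset setX A setT :|: setX setT A :|: C :|: setX Bd Bd.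
  apply/subsetP => -[p s]; rewrite inE /= => /existsP[G /and4P[pG sG prG nAG]].
  rewrite !in_setU !in_setX !in_setT /= andbT.
  have [//|pA] := boolP (p \in A); have [//|sA] := boolP (s \in A); rewrite /=.
  have [trG|ntr] := boolP (two_transitive G); last first.
    by apply/orP; left; rewrite inE /= pA inE; apply/existsP; exists G; apply/and5P.
  apply/orP; right.
  have inBd (u : 'S_n) : u \in G -> u \notin A -> u \in Bd.
    move=> uG /typicalP[uc uN]; rewrite inE; apply/andP; split.
      apply: (two_transitive_dvd_long uG prG nAG trG); rewrite card_ord.
      by apply: leq_trans small; rewrite leq_mul2l leq_mul2r uc orbT.
    apply: leq_trans (size_primes_long_prod _ _) _; rewrite card_ord.
    by rewrite leq_mul2r uN orbT.
  by rewrite !inBd.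
have leC : #|C|%:R <= n`!%:R * (2 ^+ (N * n + c * (c * L)) * n`!%:R / (uphalf n)`!%:R) :> R.
  have -> : #|C| = (\sum_(p | p \notin A) #|Us p|)%N.
    rewrite -sum1dep_card (eq_bigr (fun p => \sum_(s in Us p) 1)%N) => [|p _].
      by rewrite pair_big_dep.
    by rewrite sum1_card.
  rewrite natr_sum -[X in X%:R * _]cS -sum1_card natr_sum mulr_suml big_mkcond /=.
  rewrite [leRHS]big_mkcond; apply: ler_sum => p _; rewrite in_setT mul1r.
  case: ifPn => [pA|_]; last by rewrite divr_ge0 ?mulr_ge0 ?exprn_ge0 ?ler0n.
  rewrite ler_pdivlMr ?ltr0n ?fact_gt0 //.
  have [D [cD hD]] := pair_transversal L p; have [pc pN] := typicalP pA.
  have := @card_not_two_transitive _ p D; rewrite card_ord => /(_ n3 hD).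
  rewrite -(ler_nat R) !natrM => /le_trans; apply; rewrite ler_wpM2r ?ler0n //.
  rewrite natrX ler_weXn2l ?ler1n // (leq_trans cD) // card_ord.
  by rewrite leq_add // ?leq_mul // leq_mul2r ?pc orbT.
apply: le_trans (_ : (#|setX A setT| + #|setX setT A| + #|C| + #|setX Bd Bd|)%:R <= _).
  rewrite ler_nat; apply: leq_trans (subset_leq_card sub) _.
  apply: leq_trans (leq_card_setU _ _) _; rewrite leq_add2r.
  apply: leq_trans (leq_card_setU _ _) _; rewrite leq_add2r.
  exact: leq_card_setU.
rewrite !cardsX cS !natrD !natrM expr2 lerD2r lerD //.
by rewrite le_eqVlt; apply/orP; left; apply/eqP; ring.
Qed.

End PairsBound.

(** * Numerical estimates and choice of parameters *)

Lemma harmonic_le (F : numFieldType) n m :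
  (n < 2 ^ m)%N -> \sum_(u < n) u.+1%:R^-1 <= m%:R :> F.
Proof.
elim: m n => [|m IH] n nm; first by case: n nm => // _; rewrite big_ord0.
have [n2|n2] := ltnP n (2 ^ m); first by apply: le_trans (IH n n2) _; rewrite ler_nat.
have m0 : (0 < 2 ^ m)%N by rewrite expn_gt0.
rewrite -(subnKC (n := n) (m := (2 ^ m).-1)); last by lia.
rewrite big_split_ord /= -natr1 lerD //; first by apply: IH; lia.
apply: le_trans (_ : \sum_(u < n - (2 ^ m).-1) (2 ^ m)%:R^-1 <= _).
  apply: ler_sum => u _; rewrite lef_pV2 ?posrE ?ltr0n ?ler_nat //; lia.
rewrite sumr_const card_ord -[leLHS]mulr_natr mulrC ler_pdivrMr ?ltr0n //.
by rewrite mul1r ler_nat; move: nm; rewrite expnS; lia.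
Qed.

Lemma expn_le_fact i m : (i <= m)%N -> (i ^ (m - i) <= m`!)%N.
Proof.
move=> im; rewrite -[m in X in (_ <= X)%N](subnKC im); elim: (m - i)%N => [|d IH].
  by rewrite addn0 fact_gt0.
by rewrite addnS factS expnS leq_mul //; lia.
Qed.

(** With i = 2^(b-3) <= n/8, at least 3n/8 factors of the factorial exceed i and give the exponent
    (b-3) 3n/8. Against it stand N n <= b n/8, 16 b^2 L <= n because b >= 16, and 2(b+1) for n^2. *)
Lemma exp2_le_fact n b N L :
    (16 <= b)%N -> (2 ^ b <= n < 2 ^ b.+1)%N -> (8 * N <= b)%N -> (b ^ 3 * L <= n)%N ->
  (2 ^ (N * n + 4 * b * (4 * b * L)) * n ^ 2 <= (uphalf n)`!)%N.
Proof.
move=> b16 /andP[bn nb] Nb Ln.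
have n32 : (32 <= n)%N.
  by apply: leq_trans bn; apply: leq_trans (_ : 2 ^ 5 <= _)%N => //; rewrite leq_exp2l //; lia.
have i8 : (8 * 2 ^ (b - 3) <= n)%N.
  by apply: leq_trans bn; rewrite -(expnD 2 3) leq_exp2l //; lia.
have im : (2 ^ (b - 3) <= uphalf n)%N by rewrite uphalf_half; lia.
apply: leq_trans (expn_le_fact im); rewrite -expnM.
apply: leq_trans (_ : 2 ^ (N * n + 4 * b * (4 * b * L)) * 2 ^ (b.+1 * 2) <= _)%N.
  by rewrite leq_mul2l expnM leq_exp2r // (ltnW nb) orbT.
rewrite -expnD leq_exp2l //.
have L16 : (4 * b * (4 * b * L) <= n)%N.
  have : (b * (4 * b * (4 * b * L)) <= b * n)%N.
    apply: leq_trans (_ : 16 * (b ^ 3 * L) <= _)%N; first by rewrite !expnS expn0; lia.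
    by apply: leq_mul.
  by rewrite leq_pmul2l //; lia.
set i := (2 ^ (b - 3))%N in i8 im *.
have mi : (3 * n <= 8 * (uphalf n - i))%N by rewrite uphalf_half; lia.
rewrite -(leq_pmul2l (isT : (0 < 8)%N)).
apply: leq_trans (_ : (b - 3) * (3 * n) <= _)%N; last by rewrite [leqRHS]mulnCA leq_mul2l mi orbT.
have : (8 * N * n <= b * n)%N by rewrite leq_mul2r Nb orbT.
by move: L16 b16 n32; clear; nia.
Qed.

Section Asymptotics.

Variable R : realType.

Lemma ln2_gt0 : 0 < ln 2 :> R.
Proof. by rewrite ln_gt0 // ltr1n. Qed.

Lemma powR_trunc_log (d : R) n : 0 <= d -> (0 < n)%N ->
  expR (d * ln 2 * (trunc_log 2 n)%:R) <= n%:R `^ d.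
Proof.
move=> d0 n0; rewrite /powR pnatr_eq0 eqn0Ngt n0 ler_expR -mulrA ler_wpM2l //.
rewrite [leLHS]mulr_natr -lnXn // ler_ln ?posrE ?exprn_gt0 ?ltr0n //.
by rewrite -natrX ler_nat trunc_logP.
Qed.

Lemma polylog_le (d C : R) j : 0 < d ->
  exists n0, forall n, (n0 <= n)%N -> C * (trunc_log 2 n)%:R ^+ j <= n%:R `^ d.
Proof.
move=> d0; pose y := d * ln 2; have y0 : 0 < y by rewrite mulr_gt0 ?ln2_gt0.
(* The term of degree j + 1 in the series of [expR (y * b)] exceeds C b^j as soon as b >= C / c. *)
pose c := y ^+ j.+1 / j.+1`!%:R.
have c0 : 0 < c by rewrite divr_gt0 ?exprn_gt0 // ltr0n fact_gt0.
pose b0 := Num.bound `|C / c|; exists (2 ^ b0)%N => n hn.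
have n0 : (0 < n)%N by apply: leq_trans hn; rewrite expn_gt0.
have hb : (b0 <= trunc_log 2 n)%N by apply: trunc_log_max.
set b := trunc_log 2 n in hb *.
apply: le_trans (powR_trunc_log (ltW d0) n0); rewrite -/y -/b.
have yb : 0 <= y * b%:R by rewrite mulr_ge0 ?ler0n // ltW.
apply: le_trans (expR_ge1Dxn j yb).
apply: le_trans (_ : (y * b%:R) ^+ j.+1 / j.+1`!%:R <= _); last by rewrite lerDr.
rewrite exprMn mulrAC -/c exprS mulrA ler_wpM2r ?exprn_ge0 ?ler0n //.
rewrite mulrC -ler_pdivrMr //.
apply: le_trans (ler_norm _) _; apply: le_trans (ltW (archi_boundP (normr_ge0 _))) _.
by rewrite ler_nat.
Qed.

(** The hypothesis gives 2 N b <= (b/j)^2, hence sqrt (1 + 2 N b) <= 1 + b/j. *)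
Lemma smooth_bound_le b j N :
  (0 < j)%N -> (2 * j ^ 2 * N <= b)%N ->
  smooth_bound R (N * b) <= expR 2 * expR (2 / j%:R * b%:R).
Proof.
move=> j0 Nb; rewrite -expRD ler_expR.
have jR : 0 < j%:R :> R by rewrite ltr0n.
pose q : R := j%:R^-1 * b%:R; have -> : 2 + 2 / j%:R * b%:R = 2 * (1 + q) :> R by rewrite /q; ring.
rewrite ler_wpM2l //; have q0 : 0 <= q by rewrite mulr_ge0 ?invr_ge0 ?ler0n.
have q1 : 0 <= 1 + q by rewrite addr_ge0.
rewrite -[leRHS](ger0_norm q1) -sqrtr_sqr ler_wsqrtr //.
suff : (N * b).*2%:R <= q ^+ 2 by move: q0; nra.
rewrite /q exprMn exprVn mulrC ler_pdivlMr ?exprn_gt0 // -!natrX -natrM ler_nat.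
by move: Nb; clear; nia.
Qed.

Lemma inv_trunc_div_le n b : (0 < b)%N -> (0 < n)%N ->
  n%:R / (n %/ b ^ 3).+1%:R <= b%:R ^+ 3 :> R.
Proof.
move=> b0 n0; rewrite ler_pdivrMr ?ltr0n // -natrX -natrM ler_nat mulnC.
by apply: ltnW; rewrite ltn_ceil // expn_gt0 b0.
Qed.

(** [card_nlong_ge] is used twice: with base 2 and L = 0 for the number of all cycles, and with base
    2^(4k) for the long ones. Either way the denominator is at least 2^(4b) >= n^4 / 16; the large
    base costs only a power of b, as n/(L+1) <= b^3. *)
Lemma card_atypical_le n k (b := trunc_log 2 n) (L := (n %/ b ^ 3)%N) :
    (0 < k)%N -> (1 < b)%N ->
  #|atypical n L (4 * b) (b %/ k)|%:R / n`!%:R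
    <= 32 / n%:R ^+ 3
       + 16 * 2 ^+ (4 * k) * b%:R ^+ (3 * (2 ^ (4 * k)).-1) / n%:R ^+ 4 :> R.
Proof.
move=> k0 b1; have n0 : (0 < n)%N by rewrite lt0n; apply: contraTneq b1 => n0; rewrite /b n0.
have nR : 0 < n%:R :> R by rewrite ltr0n.
have b3 : (1 < b ^ 3)%N by rewrite (leq_trans b1) // -[X in (X <= _)%N]expn1 leq_exp2l.
have Ln : (L < n)%N by rewrite /L ltn_Pdiv.
set x := (2 ^ (4 * k))%N; have x0 : (0 < x)%N by rewrite expn_gt0.
have n2b : (n%:R ^+ 4 <= 16 * 2 ^+ (4 * b) :> R).
  rewrite -!natrX -natrM ler_nat -(expnD 2 4) -mulnS [(4 * _)%N]mulnC expnM leq_exp2r //.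
  exact/ltnW/trunc_log_ltn.
have p2 : 0 < 2 ^+ (4 * b) :> R by rewrite exprn_gt0.
have sub : atypical n L (4 * b) (b %/ k) \subset
    [set s : 'S_n | (4 * b <= nlong 0 s)%N] :|: [set s : 'S_n | (b %/ k < nlong L s)%N].
  apply/subsetP => s; rewrite !inE => /orP[h|->]; last by rewrite orbT.
  rewrite (_ : nlong 0 s = #|porbits s|) ?(ltnW h) //; apply: eq_card => C.
  rewrite inE; case: imsetP => // -[y _ ->]; exact: card_porbit_gt0.
have nf : 0 < n`!%:R :> R by rewrite ltr0n fact_gt0.
rewrite ler_pdivrMr //.
apply: le_trans (_ : (#|[set s : 'S_n | (4 * b <= nlong 0 s)%N]| +
    #|[set s : 'S_n | (b %/ k < nlong L s)%N]|)%:R <= _).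
  by rewrite ler_nat; apply: leq_trans (subset_leq_card sub) (leq_card_setU _ _).
rewrite natrD mulrDl lerD //.
  have := @card_nlong_ge R 'I_n 0 2 (4 * b) isT; rewrite card_ord => /(_ n0) /le_trans; apply.
  rewrite mulrC ler_wpM2r ?(ltW nf) // divr1 expr1 ler_pdivrMr // mulrAC ler_pdivlMr ?exprn_gt0 //.
  rewrite -mulrA -exprS; move: n2b; lra.
have := @card_nlong_ge R 'I_n L x (b %/ k).+1 x0; rewrite card_ord => /(_ Ln) /le_trans; apply.
rewrite mulrC ler_wpM2r ?(ltW nf) //.
have xb : 2 ^+ (4 * b) <= x%:R ^+ (b %/ k).+1 :> R.
  rewrite natrX -exprM ler_weXn2l ?ler1n // -mulnA leq_mul2l /= mulnC.
  by apply: ltnW; apply: ltn_ceil.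
have xp : 0 < x%:R ^+ (b %/ k).+1 :> R by apply: lt_le_trans xb.
rewrite ler_pdivrMr // mulrAC ler_pdivlMr ?exprn_gt0 //.
have q3 : (n%:R / L.+1%:R) ^+ x.-1 <= b%:R ^+ (3 * x.-1) :> R.
  rewrite exprM lerXn2r ?nnegrE ?divr_ge0 ?exprn_ge0 ?ler0n //.
  by apply: inv_trunc_div_le => //; apply: ltnW.
have q0 : 0 <= (n%:R / L.+1%:R) ^+ x.-1 :> R by rewrite exprn_ge0 ?divr_ge0.
have -> : 2 ^+ (4 * k) = x%:R :> R by rewrite natrX.
have xR : 0 <= x%:R :> R by [].
have := ler_pM q0 (exprn_ge0 4 (ltW nR)) q3 (le_trans n2b (ler_wpM2l _ xb)).
move/(_ (ler0n _ _))/(ler_wpM2l xR)/le_trans; rewrite !mulrA; apply.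
by rewrite le_eqVlt; apply/orP; left; apply/eqP; ring.
Qed.

(** In [card_dvd_long_le] multiplied by n, n/(L+1) is at most b^3 and the harmonic sum at most b +
    1, so beyond the smooth bound only a factor of order b^4 is lost. *)
Lemma card_dvd_long_set_le n j (b := trunc_log 2 n) (L := (n %/ b ^ 3)%N)
    (N := (b %/ (2 * j ^ 2))%N) :
    (0 < j)%N -> (1 < b)%N ->
  n%:R * (#|dvd_long_set 'I_n L (N * b)|%:R / n`!%:R)
    <= 4 * expR 2 * b%:R ^+ 4 * expR (2 / j%:R * b%:R) :> R.
Proof.
move=> j0 b1; have n0 : (0 < n)%N by rewrite lt0n; apply: contraTneq b1 => n0; rewrite /b n0.
have nR : 0 < n%:R :> R by rewrite ltr0n.
have nf : 0 < n`!%:R :> R by rewrite ltr0n fact_gt0.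
have k0 : (0 < 2 * j ^ 2)%N by rewrite muln_gt0 expn_gt0 j0.
have NE : (2 * j ^ 2 * N <= b)%N by rewrite mulnC leq_divM.
have := @card_dvd_long_le R 'I_n L (N * b); rewrite card_ord => /(_ n0).
rewrite mulrC -ler_pdivrMr // => /(ler_wpM2l (ltW nR)) /le_trans; apply.
have := smooth_bound_le j0 NE; set E := smooth_bound R _ => leE.
set H := \sum_(u < n) _; have leH : H <= b%:R + 1.
  by rewrite natr1; apply: harmonic_le; rewrite trunc_log_ltn.
have H0 : 0 <= H by apply: sumr_ge0 => u _; rewrite invr_ge0.
have E1 : 1 <= E by rewrite -[leLHS]expR0 ler_expR mulr_ge0 // sqrtr_ge0.
have E0 := le_trans ler01 E1.
have bR : 1 <= b%:R :> R by rewrite ler1n ltnW.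
have b0 := le_trans ler01 bR.
have EH : 0 <= 1 + E * H by rewrite addr_ge0 ?mulr_ge0.
apply: le_trans (_ : E + b%:R ^+ 3 * (1 + E * H) <= _).
  rewrite mulrDr mulrCA divff ?gt_eqF // mulr1 lerD2l mulrCA [leRHS]mulrC ler_wpM2l //.
  by apply: inv_trunc_div_le => //; apply: ltnW.
apply: le_trans (_ : 4 * b%:R ^+ 4 * E <= _); last first.
  apply: le_trans (ler_wpM2l _ leE) _; first by rewrite mulr_ge0 ?exprn_ge0.
  by rewrite le_eqVlt; apply/orP; left; apply/eqP; ring.
apply: le_trans (_ : E + b%:R ^+ 3 * (E + E * (b%:R + 1)) <= _).
  rewrite lerD2l ler_wpM2l ?exprn_ge0 // lerD // ler_wpM2l //.
have b3 : 1 <= b%:R ^+ 3 :> R by rewrite exprn_ege1.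
rewrite [X in 4 * X]exprS.
move: (b%:R ^+ 3 : R) b3 => y y1.
rewrite -subr_ge0.
have -> : 4 * (b%:R * y) * E - (E + y * (E + E * (b%:R + 1))) =
  E * (2 * y * (b%:R - 1) + (b%:R * y - 1)) by ring.
rewrite mulr_ge0 // addr_ge0 // ?subr_ge0.
  by rewrite !mulr_ge0 // ?subr_ge0 // (le_trans ler01).
exact: mulr_ege1.
Qed.

End Asymptotics.

Theorem theorem1p3 (R : realType) (eps : R) (heps : 0 < eps) :
  exists n0 : nat, forall n : nat, (n0 <= n)%N ->
    P2 R n <= n%:R `^ (-2 + eps).
Proof.
have l2 := ln2_gt0 R; have el2 : 0 < eps * ln 2 by rewrite mulr_gt0.
(* Chosen so that [expR (2 / j%:R * b%:R)] is at most n^(eps/8); j >= 2 ensures k = 2 j^2 >= 8,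
   hence 8 N <= b as [exp2_le_fact] requires. *)
pose j := maxn 2 (Num.bound (16 / (eps * ln 2))).
have j2 : (2 <= j)%N by rewrite leq_maxl.
have j0 : (0 < j)%N by apply: leq_trans j2.
have jle : 2 / j%:R <= eps / 8 * ln 2.
  rewrite ler_pdivrMr ?ltr0n //.
  have : 16 / (eps * ln 2) <= j%:R.
    apply: ltW; apply: lt_le_trans (archi_boundP _) _; first by rewrite divr_ge0 // ltW.
    by rewrite ler_nat leq_maxr.
  rewrite ler_pdivrMr //; lra.
pose k := (2 * j ^ 2)%N.
have k8 : (8 <= k)%N by rewrite (leq_mul2l 2 4) /= -(leq_exp2r _ _ (isT : 0 < 2)%N) in j2 *.
pose e := (3 * (2 ^ (4 * k)).-1)%N.
have [n1 h1] := polylog_le (32 * 2 ^+ (4 * k) : R) e ltr01.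
have [n2 h2] : exists n0, forall n, (n0 <= n)%N ->
    4 * expR 2 * (trunc_log 2 n)%:R ^+ 4 <= n%:R `^ (eps / 8).
  by apply: polylog_le; rewrite divr_gt0.
have [n3 h3] : exists n0, forall n, (n0 <= n)%N ->
    3 * (trunc_log 2 n)%:R ^+ 0 <= n%:R `^ (eps / 2).
  by apply: polylog_le; rewrite divr_gt0.
(* 2^16 ensures b >= 16. The other thresholds let powers of n absorb, in turn, the power of b in
   [card_atypical_le], the one in [card_dvd_long_set_le], and the constant 3. *)
exists (maxn (2 ^ 16) (maxn n1 (maxn n2 n3))) => n; rewrite !geq_max.
case/and4P => n16 /h1 {}h1 /h2 {}h2 /h3; rewrite expr0 mulr1 => {}h3.
pose b := trunc_log 2 n; rewrite -/b in h1 h2.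
have b16 : (16 <= b)%N by apply: trunc_log_max.
have n0 : (0 < n)%N by apply: leq_trans n16; rewrite expn_gt0.
have n64 : (64 <= n)%N by apply: leq_trans n16; rewrite (_ : 64 = 2 ^ 6)%N // leq_exp2l.
pose L := (n %/ b ^ 3)%N; pose N := (b %/ k)%N.
have Lb : (b ^ 3 * L <= n)%N by rewrite mulnC leq_divM.
have small : (10 * (4 * b * L) <= n)%N.
  apply: leq_trans Lb; rewrite !mulnA leq_mul2r !expnS expn0; apply/orP; right.
  by move: b16; clear; nia.
have k0 : (0 < k)%N by apply: leq_trans k8.
have b1 : (1 < b)%N by apply: leq_trans b16.
have b2n : (2 ^ b <= n < 2 ^ b.+1)%N by rewrite trunc_logP // trunc_log_ltn.
have kN : (8 * N <= b)%N by apply: leq_trans (leq_divM b k); rewrite mulnC leq_mul2l k8 orbT.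
have nR : 0 < n%:R :> R by rewrite ltr0n.
have nf : 0 < n`!%:R :> R by rewrite ltr0n fact_gt0.
have n3' : (3 < n)%N by apply: leq_trans n64.
have := @card_primitive_pairs R n L (4 * b) N n3' small.
have := card_atypical_le R k0 b1; rewrite -/b -/L -/N -/e.
have := card_dvd_long_set_le R j0 b1; rewrite -/b -/L -/k -/N.
set A : R := #|atypical _ _ _ _|%:R; set Bd : R := #|dvd_long_set _ _ _|%:R => leB leA lePP.
have leD := exp2_le_fact b16 b2n kN Lb.
set D := (N * n + _)%N in leD lePP.
have u0 : 0 < (uphalf n)`!%:R :> R by rewrite ltr0n fact_gt0.
have leP2 : P2 R n <= 2 * (A / n`!%:R) + 2 ^+ D / (uphalf n)`!%:R + (Bd / n`!%:R) ^+ 2.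
  rewrite /P2 /uniform_prob card_prod card_Sn natrM ler_pdivrMr ?mulr_gt0 //.
  apply: le_trans lePP _; rewrite le_eqVlt; apply/orP; left; apply/eqP.
  have fieldE (a d B f u : R) : f != 0 -> u != 0 ->
      2 * f * a + f * (d * f / u) + B ^+ 2 = (2 * (a / f) + d / u + (B / f) ^+ 2) * (f * f).
    by move=> f0' u0'; field; rewrite f0' u0'.
  by apply: fieldE; rewrite gt_eqF.
have X2 : 0 < n%:R ^+ 2 :> R by rewrite exprn_gt0.
have X1 : 64 <= n%:R :> R by rewrite ler_nat.
have t1 : 2 * (A / n`!%:R) <= 2 / n%:R ^+ 2.
  apply: le_trans (ler_wpM2l _ leA) _ => //.
  have le1 : 32 / n%:R ^+ 3 <= 1 / 2 / n%:R ^+ 2 :> R.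
    rewrite exprS invfM mulrA ler_wpM2r ?invr_ge0 ?(ltW X2) // ler_pdivrMr //.
    by move: X1; clear; lra.
  have le2 : 16 * 2 ^+ (4 * k) * b%:R ^+ e / n%:R ^+ 4 <= 1 / 2 / n%:R ^+ 2 :> R.
    have gen (x y z : R) : 64 <= x -> 32 * z * y <= x -> 16 * z * y / x ^+ 4 <= 1 / 2 / x ^+ 2.
      move=> hx hz; have x0 : 0 < x by apply: lt_le_trans hx.
      rewrite ler_pdivrMr ?exprn_gt0 //.
      have -> : 1 / 2 / x ^+ 2 * x ^+ 4 = 1 / 2 * x * x by field; rewrite gt_eqF.
      have -> : 16 * z * y = 32 * z * y / 2 by field.
      by move: hx hz; clear; nra.
    by apply: gen => //; move: h1; rewrite powRr1 ?ler0n.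
  by move: le1 le2; move: (32 / n%:R ^+ 3 : R) (_ / n%:R ^+ 4 : R) ((n%:R ^+ 2 : R)^-1); clear => *; lra.
have t2 : 2 ^+ D / (uphalf n)`!%:R <= 1 / n%:R ^+ 2 :> R.
  by rewrite ler_pdivrMr // mulrAC mul1r ler_pdivlMr // -!natrX -natrM ler_nat.
set Y := n%:R `^ (eps / 2) in h3 *.
have t3 : (Bd / n`!%:R) ^+ 2 <= Y / n%:R ^+ 2.
  rewrite ler_pdivlMr // -exprMn mulrC.
  have -> : Y = (n%:R `^ (eps / 8) * n%:R `^ (eps / 8)) ^+ 2.
    rewrite -powRD; last by rewrite pnatr_eq0 -lt0n n0 implybT.
    rewrite -powR_mulrn ?powR_ge0 // -powRrM /Y; congr (_ `^ _); clear; lra.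
  rewrite lerXn2r ?nnegrE ?mulr_ge0 ?powR_ge0 ?invr_ge0 ?ler0n //.
  apply: le_trans leB _; apply: ler_pM; rewrite ?mulr_ge0 ?expR_ge0 ?exprn_ge0 ?ler0n //.
  apply: le_trans (powR_trunc_log _ n0); last by rewrite divr_ge0 // ltW.
  by rewrite ler_expR ler_wpM2r ?ler0n.
apply: le_trans leP2 _; apply: le_trans (lerD (lerD t1 t2) t3) _.
rewrite -!mulrDl powRD; last by rewrite pnatr_eq0 -lt0n n0 implybT.
rewrite powR_invn ?ler0n // mulrC ler_wpM2l ?invr_ge0 ?(ltW X2) //.
have -> : n%:R `^ eps = Y ^+ 2.
  by rewrite -powR_mulrn ?powR_ge0 // -powRrM; congr (_ `^ _); clear; lra.
(* The terms add up to (2 + 1 + Y) / n^2, and 3 + Y <= Y^2 because Y >= 3. *)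
by move: h3; clear; nra.
Qed.
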